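(* Let $\mathbb F$ be any field and let $\mathcal A=\|A_1|A_2\|$ be an $m\times n\times 2$ spatial matrix over $\mathbb F$ such that $\min(m,n)$ is less than or equal to the number of elements of $\mathbb F$. Then $\mathcal A$ is equivalent to some $m\times n\times 2$ spatial matrix $\mathcal B=\|B_1|B_2\|$ in which \[ (B_1,B_2)=\bigoplus_{i=1}^{p_1}(F_{r_i},G_{r_i})\oplus\bigoplus_{j=1}^{p_2}(F_{s_j}^T,G_{s_j}^T)\oplus\bigoplus_{k=1}^{q}(I_{l_k},\Phi_{\chi_k}), \] where $p_1,p_2,q$ are nonnegative integers, all $r_i,s_j,l_k$ are natural numbers (positive integers), and each $\chi_k\in\mathbb F[x]$ is a monic polynomial of degree $l_k$ which is a power of an irreducible polynomial. Moreover, this direct sum is determined by $\mathcal A$ uniquely, up to permutation of summands and up to simultaneous replacement of all $\Phi_{\chi_k}$ ($k=1,\dots,q$) by $\Phi_{\eta_k}$ with \[ \eta_k(x):=\varepsilon_k (d-xb)^{l_k}\,\chi_k\!\left(\frac{xa-c}{d-xb}\right), \] where $a,b,c,d$ are arbitrary elements of $\mathbb F$ (the same for all $k$) satisfying $ad-bc\neq 0$ and $a+b\lambda_k\ne 0$ whenever $\chi_k(x)=(x-\lambda_k)^{l_k}$ for some $\lambda_k\in\mathbb F$, and each $\varepsilon_k$ is the nonzero element of $\mathbb F$ making $\eta_k$ monic.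
   Context: An $m\times n\times q$ spatial matrix over $\mathbb F$ is an array $\mathcal A=[a_{ijk}]$ ($1\le i\le m$, $1\le j\le n$, $1\le k\le q$) with entries in $\mathbb F$; it is written as $\|A_1|\dots|A_q\|$ where $A_k=[a_{ijk}]_{ij}$ are its $m\times n$ horizontal slices. Two $m\times n\times q$ spatial matrices $[a_{ijk}]$ and $[b_{ijk}]$ are equivalent if there are nonsingular matrices $R=[r_{ii'}]$ ($m\times m$), $S=[s_{jj'}]$ ($n\times n$), $T=[t_{kk'}]$ ($q\times q$) with $b_{i'j'k'}=\sum_{i,j,k}a_{ijk}r_{ii'}s_{jj'}t_{kk'}$ for all $i',j',k'$. Matrices with zero rows or columns are allowed: $0_{m0}$ and $0_{0n}$ denote the matrices of the maps $0\to\mathbb F^m$ and $\mathbb F^n\to 0$, and direct sums with them add zero rows/columns accordingly. The direct sum of pairs is $(A,B)\oplus(A',B')=(A\oplus A',B\oplus B')$. For a natural number $r$, $F_r$ and $G_r$ are the $(r-1)\times r$ matrices $F_r=[I_{r-1}\ \ 0]$ (identity followed by a zero column) and $G_r=[0\ \ I_{r-1}]$ (a zero column followed by the identity); in particular $F_1,G_1$ are $0\times 1$. For a monic $\chi(x)=x^l-u_1x^{l-1}-\dots-u_l\in\mathbb F[x]$, $l\ge1$, $\Phi_\chi$ is the $l\times l$ companion matrix with ones on the subdiagonal, last column $(u_l,\dots,u_2,u_1)^T$ (read top to bottom), and zeros elsewhere; its characteristic polynomial is $\chi$. *)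

(* Defs.v *)
From HB Require Import structures.
From mathcomp Require Import all_boot all_order all_algebra.
Set Implicit Arguments. Unset Strict Implicit. Unset Printing Implicit Defensive.
Import GRing.Theory.
Local Open Scope ring_scope.

Section Defs.
Variable F : fieldType.

(* An m x n x q spatial matrix with q = 2, given by its two horizontal
   slices; dimensions are carried along so that direct sums of blocks of
   arbitrary sizes (including zero rows/columns) can be formed. *)
Record pencil := Pencil {
  prow : nat; pcol : nat;
  ps1 : 'M[F]_(prow, pcol); ps2 : 'M[F]_(prow, pcol) }.

Definition slice m n (A1 A2 : 'M[F]_(m, n)) (k : 'I_2) : 'M[F]_(m, n) :=
  if (val k == 0)%N then A1 else A2.

Definition sp_equiv m n (A1 A2 B1 B2 : 'M[F]_(m, n)) : Prop :=
  exists (R : 'M[F]_m) (S : 'M[F]_n) (T : 'M[F]_2),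
    [/\ R \in unitmx, S \in unitmx, T \in unitmx &
      forall (i' : 'I_m) (j' : 'I_n) (k' : 'I_2),
        slice B1 B2 k' i' j' =
        \sum_(i < m) \sum_(j < n) \sum_(k < 2)
           slice A1 A2 k i j * R i i' * S j j' * T k k'].

Definition pencil_equiv (P Q : pencil) : Prop :=
  exists (em : prow P = prow Q) (en : pcol P = pcol Q),
    sp_equiv (castmx (em, en) (ps1 P)) (castmx (em, en) (ps2 P))
             (ps1 Q) (ps2 Q).

Definition pdsum (P Q : pencil) : pencil :=
  Pencil (block_mx (ps1 P) 0 0 (ps1 Q)) (block_mx (ps2 P) 0 0 (ps2 Q)).

Definition pempty : pencil := Pencil (0 : 'M[F]_(0, 0)) 0.

Definition dsum (L : seq pencil) : pencil := foldr pdsum pempty L.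

Definition Fmx (r : nat) : 'M[F]_(r.-1, r) :=
  \matrix_(i < r.-1, j < r) ((i : nat) == j)%:R.
Definition Gmx (r : nat) : 'M[F]_(r.-1, r) :=
  \matrix_(i < r.-1, j < r) ((i.+1 : nat) == j)%:R.

(* Companion matrix Phi_chi of chi = x^l - u_1 x^{l-1} - ... - u_l
   (l = deg chi): ones on the subdiagonal, last column (u_l,...,u_1)^T. *)
Definition Phi (chi : {poly F}) : 'M[F]_((size chi).-1) :=
  \matrix_(i < (size chi).-1, j < (size chi).-1)
    ((if (j : nat) == ((size chi).-1).-1 then - chi`_i else 0)
     + ((i : nat) == j.+1)%:R).

Definition blockF (r : nat) : pencil := Pencil (Fmx r) (Gmx r).
Definition blockFT (s : nat) : pencil := Pencil (Fmx s)^T (Gmx s)^T.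
Definition blockPhi (chi : {poly F}) : pencil :=
  Pencil (1%:M : 'M[F]_((size chi).-1)) (Phi chi).

Definition canon (rs ss : seq nat) (chis : seq {poly F}) : pencil :=
  dsum (map blockF rs ++ map blockFT ss ++ map blockPhi chis).

Definition primary_monic (chi : {poly F}) : Prop :=
  [/\ chi \is monic, (1 < size chi)%N &
      exists2 p : {poly F}, irreducible_poly p & exists e : nat, chi = p ^+ e].

Definition canon_data (rs ss : seq nat) (chis : seq {poly F}) : Prop :=
  [/\ all (fun r => 0 < r)%N rs, all (fun s => 0 < s)%N ss &
      forall chi, chi \in chis -> primary_monic chi].

Definition is_canonical_form (A : pencil) rs ss chis : Prop :=
  canon_data rs ss chis /\ pencil_equiv A (canon rs ss chis).

(* (d - x b)^l chi((x a - c)/(d - x b)), l = deg chi, as a polynomial. *)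
Definition eta_raw (a b c d : F) (chi : {poly F}) : {poly F} :=
  \sum_(i < size chi)
     chi`_i *: (('X * a%:P - c%:P) ^+ i * (d%:P - 'X * b%:P) ^+ ((size chi).-1 - i)).

Definition eta (a b c d : F) (chi : {poly F}) : {poly F} :=
  (lead_coef (eta_raw a b c d chi))^-1 *: eta_raw a b c d chi.

Definition admissible (a b c d : F) (chis : seq {poly F}) : Prop :=
  a * d - b * c != 0 /\
  forall chi, chi \in chis -> forall lam : F,
    chi = ('X - lam%:P) ^+ (size chi).-1 -> a + b * lam != 0.

Definition related (rs ss : seq nat) (chis : seq {poly F}) (rs' ss' : seq nat) (chis' : seq {poly F}) : Prop :=
  [/\ perm_eq rs rs', perm_eq ss ss' &
      exists a b c d : F, admissible a b c d chis /\
        perm_eq chis' (map (eta a b c d) chis)].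

End Defs.

(* Main.v *)
Require Import Defs.
From HB Require Import structures.
From mathcomp Require Import all_boot all_order all_algebra.
From mathcomp Require Import ring.
From Stdlib Require Import Classical.
Local Open Scope ring_scope.

Set Implicit Arguments.
Unset Strict Implicit.
Unset Printing Implicit Defensive.
Import GRing.Theory Defs.

(** The existence part: by induction on the dimensions, every nonempty pencil
    [(A, B)] has a direct summand among [(F_r, G_r)], [(F_s^T, G_s^T)],
    [(I, Phi_chi)] and [J_l], the block with nilpotent [A] and [B = I].  If [A] is
    invertible, this is the splitting off of a maximal primary cyclic
    [F[x]]-submodule.  If [ker A] is nonzero, a summand of the pencil induced on
    [V / ker A -> W / B (ker A)] lifts, growing by one row and column when its own
    [A] is not injective; the remaining case follows by transposition.  Since
    [min(m,n) <= |F|], some substitution of the slices leaves no eigenvalue at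
    infinity, which turns every [J_l] into some [(I, Phi_chi)].

    The uniqueness part is the Krull-Schmidt theorem: all the blocks have local
    endomorphism rings.  These rings do not change under an invertible substitution
    of the slices, so the substitution maps blocks to blocks: [(F_r, G_r)] to itself,
    by its dimensions, and [(I, Phi_chi)] to some [(I, Phi_psi)], where [psi] is the
    [eta] of the statement because [eta] annihilates the transformed matrix and has
    the right degree. *)

(** * Morphisms of pencils *)

(** The bound on [min(m,n)] comes from a count. For the new first slice [B - x A], a summand
    [(I, Phi_chi)] forbids at most one value of [x]: its eigenvalue [lam], when [chi] is a power of
    [X - lam]. Each such summand and each [J_l] takes up at least one row and one column, so
    together they number at most [min(m,n)]. If some [J_l] occurs, the summands [(I, Phi_chi)] are
    strictly fewer than that, and a value of [x] is left over; if none occurs, the identity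
    substitution will do.

    Passing to the quotient by [ker A] loses only the component of [A] that lands in [B (ker A)]. On
    [V / ker A] the induced [A] and this component are jointly injective, so morphisms between
    quotients extend: the equation for the missing blocks is solved by a left inverse.

    Direct summands are handled as retracts, which compose and lift easily; the complement is
    recovered at the end by splitting an idempotent. *)

Section Arrows.
Variable F : fieldType.
Implicit Types P Q R S X Y : pencil F.

(** Arbitrary pairs of matrices, with compatibility with the slices left to the predicate [hom]:
    sums and composites of arrows then carry no proofs. *)
Definition arr P Q : Type := ('M[F]_(prow Q, prow P) * 'M[F]_(pcol Q, pcol P))%type.
HB.instance Definition _ P Q := GRing.Zmodule.copy (arr P Q)
  ('M[F]_(prow Q, prow P) * 'M[F]_(pcol Q, pcol P))%type.

Definition aone P : arr P P := (1%:M, 1%:M).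
Definition acomp P Q R (g : arr Q R) (f : arr P Q) : arr P R :=
  (g.1 *m f.1, g.2 *m f.2).
End Arrows.

Notation "g \oa f" := (acomp g f) (at level 40, left associativity).
Arguments aone {F P}.

Section Category.
Variable F : fieldType.
Implicit Types P Q R S X Y : pencil F.

Definition hom P Q (f : arr P Q) : Prop :=
  f.1 *m ps1 P = ps1 Q *m f.2 /\ f.1 *m ps2 P = ps2 Q *m f.2.

Definition unitarr P Q (f : arr P Q) : Prop :=
  exists g : arr Q P, g \oa f = aone /\ f \oa g = aone.

Definition iso P Q : Prop := exists2 f : arr P Q, hom f & unitarr f.

Definition retract P Q : Prop :=
  exists (f : arr P Q) (g : arr Q P), [/\ hom f, hom g & g \oa f = aone].

(** Inverses are taken among all arrows; by [hom_inv] the inverse of a morphism is a morphism, so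
    this is locality of the endomorphism ring. *)
Definition local P : Prop :=
  aone != 0 :> arr P P /\
  forall f : arr P P, hom f -> unitarr f \/ unitarr (aone - f).

Lemma acompA P Q R S (h : arr R S) (g : arr Q R) (f : arr P Q) :
  h \oa (g \oa f) = h \oa g \oa f.
Proof. by rewrite /acomp /= !mulmxA. Qed.

Lemma acomp1l P Q (f : arr P Q) : aone \oa f = f.
Proof. by case: f => a b; rewrite /acomp /= !mul1mx. Qed.

Lemma acomp1r P Q (f : arr P Q) : f \oa aone = f.
Proof. by case: f => a b; rewrite /acomp /= !mulmx1. Qed.

Lemma acompDl P Q R (g g' : arr Q R) (f : arr P Q) :
  (g + g') \oa f = g \oa f + g' \oa f.
Proof. by rewrite /acomp /= !mulmxDl. Qed.

Lemma acompDr P Q R (g : arr Q R) (f f' : arr P Q) :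
  g \oa (f + f') = g \oa f + g \oa f'.
Proof. by rewrite /acomp /= !mulmxDr. Qed.

Lemma acompNl P Q R (g : arr Q R) (f : arr P Q) : (- g) \oa f = - (g \oa f).
Proof. by rewrite /acomp /= !mulNmx. Qed.

Lemma acompNr P Q R (g : arr Q R) (f : arr P Q) : g \oa (- f) = - (g \oa f).
Proof. by rewrite /acomp /= !mulmxN. Qed.

Lemma acomp0l P Q R (f : arr P Q) : (0 : arr Q R) \oa f = 0.
Proof. by rewrite /acomp /= !mul0mx. Qed.

Lemma acomp0r P Q R (g : arr Q R) : g \oa (0 : arr P Q) = 0.
Proof. by rewrite /acomp /= !mulmx0. Qed.

Lemma acompBl P Q R (g g' : arr Q R) (f : arr P Q) :
  (g - g') \oa f = g \oa f - g' \oa f.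
Proof. by rewrite acompDl acompNl. Qed.

Lemma acompBr P Q R (g : arr Q R) (f f' : arr P Q) :
  g \oa (f - f') = g \oa f - g \oa f'.
Proof. by rewrite acompDr acompNr. Qed.

Lemma hom_one P : hom (@aone _ P).
Proof. by split; rewrite /= mul1mx mulmx1. Qed.

Lemma hom_comp P Q R (g : arr Q R) (f : arr P Q) : hom g -> hom f -> hom (g \oa f).
Proof.
by move=> [g1 g2] [f1 f2]; split; rewrite /= -mulmxA ?f1 ?f2 mulmxA ?g1 ?g2 mulmxA.
Qed.

Lemma hom_add P Q (f g : arr P Q) : hom f -> hom g -> hom (f + g).
Proof.
by move=> [f1 f2] [g1 g2]; split; rewrite /= mulmxDl mulmxDr ?f1 ?f2 ?g1 ?g2.
Qed.

Lemma hom_opp P Q (f : arr P Q) : hom f -> hom (- f).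
Proof. by move=> [f1 f2]; split; rewrite /= mulNmx mulmxN ?f1 ?f2. Qed.

Lemma hom_sub P Q (f g : arr P Q) : hom f -> hom g -> hom (f - g).
Proof. by move=> hf hg; apply: hom_add => //; apply: hom_opp. Qed.

Lemma hom_inv P Q (f : arr P Q) (g : arr Q P) :
  hom f -> g \oa f = aone -> f \oa g = aone -> hom g.
Proof.
move=> [f1 f2] [gf1 gf2] [fg1 fg2]; split.
  by rewrite -[LHS]mulmx1 -fg2 mulmxA -(mulmxA g.1) -f1 mulmxA gf1 mul1mx.
by rewrite -[LHS]mulmx1 -fg2 mulmxA -(mulmxA g.1) -f2 mulmxA gf1 mul1mx.
Qed.

Lemma unitarr_comp P Q R (g : arr Q R) (f : arr P Q) :
  unitarr g -> unitarr f -> unitarr (g \oa f).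
Proof.
move=> [g' [g'g gg']] [f' [f'f ff']]; exists (f' \oa g'); split.
  by rewrite acompA -(acompA f') g'g acomp1r.
by rewrite acompA -(acompA g) ff' acomp1r.
Qed.

Lemma unitarr_one P : unitarr (@aone _ P).
Proof. by exists aone; rewrite acomp1l. Qed.

Lemma unitarr_endo P (f : arr P P) :
  f.1 \in unitmx -> f.2 \in unitmx -> unitarr f.
Proof.
move=> u1 u2; exists (invmx f.1, invmx f.2).
by split; rewrite /acomp /= ?mulVmx ?mulmxV.
Qed.

Lemma iso_refl P : iso P P.
Proof. by exists aone; [apply: hom_one | apply: unitarr_one]. Qed.

Lemma iso_sym P Q : iso P Q -> iso Q P.
Proof.
move=> [f hf [g [gf fg]]]; exists g; first exact: (hom_inv hf).
by exists f.
Qed.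

Lemma iso_trans P Q R : iso P Q -> iso Q R -> iso P R.
Proof.
move=> [f hf uf] [g hg ug]; exists (g \oa f); first exact: hom_comp.
exact: unitarr_comp.
Qed.

Lemma unitarr_dims P Q (f : arr P Q) :
  unitarr f -> prow P = prow Q /\ pcol P = pcol Q.
Proof.
move=> [g [[gf1 gf2] [fg1 fg2]]].
by split; apply/eqP; rewrite eqn_leq (mulmx1_min gf1, mulmx1_min gf2)
  (mulmx1_min fg1, mulmx1_min fg2).
Qed.

Lemma iso_dims P Q : iso P Q -> prow P = prow Q /\ pcol P = pcol Q.
Proof. by move=> [f _ /unitarr_dims]. Qed.

Lemma iso_retract P Q : iso P Q -> retract P Q.
Proof.
by move=> [f hf [g [gf fg]]]; exists f, g; split=> //; apply: (hom_inv hf).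
Qed.

Lemma retract_trans P Q R : retract P Q -> retract Q R -> retract P R.
Proof.
move=> [f [g [hf hg gf]]] [f' [g' [hf' hg' gf']]].
exists (f' \oa f), (g \oa g'); split; try exact: hom_comp.
by rewrite acompA -(acompA g) gf' acomp1r.
Qed.

Lemma retract_unit P Q (f : arr P Q) (g : arr Q P) :
  hom f -> hom g -> unitarr (g \oa f) -> retract P Q.
Proof.
move=> hf hg [w [w1 w2]]; exists f, (w \oa g); split=> //; last by rewrite -acompA.
by apply: (hom_comp _ hg); apply: (hom_inv (hom_comp hg hf) w1 w2).
Qed.

Lemma neq0_aone P : (0 < prow P + pcol P)%N -> aone != 0 :> arr P P.
Proof.
move=> h; apply/eqP => -[e1 e2]; move: h; rewrite addn_gt0 => /orP[] h.
  have /matrixP/(_ (Ordinal h) (Ordinal h)) := e1.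
  by rewrite !mxE eqxx => /eqP; rewrite oner_eq0.
have /matrixP/(_ (Ordinal h) (Ordinal h)) := e2.
by rewrite !mxE eqxx => /eqP; rewrite oner_eq0.
Qed.

(** [f \oa g] is an idempotent of a local ring, hence 1 or 0, and 0 would force the identity of [P]
    to vanish. *)
Lemma retract_local_unit P Q (f : arr P Q) (g : arr Q P) :
  hom f -> hom g -> g \oa f = aone -> aone != 0 :> arr P P -> local Q -> unitarr f.
Proof.
move=> hf hg gf nz [_ lQ].
have idem : f \oa g \oa (f \oa g) = f \oa g.
  by rewrite acompA -(acompA f) gf acomp1r.
case: (lQ _ (hom_comp hf hg)) => -[w [w1 w2]].
  exists g; split=> //; rewrite -[LHS]acomp1l -w1 -!acompA.
  by rewrite [in LHS](acompA f g) idem w1.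
have fg0 : f \oa g = 0.
  have : (aone - f \oa g) \oa (f \oa g) = 0 by rewrite acompBl acomp1l idem subrr.
  by move=> /(congr1 (acomp w)); rewrite acompA w1 acomp1l acomp0r.
case/eqP: nz; rewrite -gf -[g \oa f]acomp1r -gf acompA -(acompA g) fg0.
by rewrite acomp0r acomp0l.
Qed.

Lemma retract_local_iso P Q :
  retract P Q -> aone != 0 :> arr P P -> local Q -> iso P Q.
Proof.
move=> [f [g [hf hg gf]]] nz lQ; exists f => //.
exact: (retract_local_unit hf hg gf).
Qed.

End Category.

(** * Direct sums, described by injections and projections *)

Section Biproducts.
Variable F : fieldType.
Implicit Types P Q R S X Y : pencil F.

(** Working with these equations replaces block matrix computations and avoids casts: [pdsum] is
    associative and commutative only up to isomorphism. *)
Definition biprod P Q X (i1 : arr P X) (i2 : arr Q X)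
    (p1 : arr X P) (p2 : arr X Q) : Prop :=
  [/\ [/\ hom i1, hom i2, hom p1 & hom p2],
      p1 \oa i1 = aone /\ p2 \oa i2 = aone,
      p1 \oa i2 = 0, p2 \oa i1 = 0 & i1 \oa p1 + i2 \oa p2 = aone].

Definition emb1 P Q : arr P (pdsum P Q) := (col_mx 1%:M 0, col_mx 1%:M 0).
Definition emb2 P Q : arr Q (pdsum P Q) := (col_mx 0 1%:M, col_mx 0 1%:M).
Definition proj1 P Q : arr (pdsum P Q) P := (row_mx 1%:M 0, row_mx 1%:M 0).
Definition proj2 P Q : arr (pdsum P Q) Q := (row_mx 0 1%:M, row_mx 0 1%:M).

Lemma pdsum_biprod P Q : biprod (emb1 P Q) (emb2 P Q) (proj1 P Q) (proj2 P Q).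
Proof.
split; rewrite /acomp /=.
- by split; split; rewrite /= ?(mul_block_col, mul_row_block, mul_mx_row, mul_col_mx)
    ?(mul1mx, mulmx1, mul0mx, mulmx0, addr0, add0r).
- by split; rewrite !mul_row_col ?(mul1mx, mulmx1, mul0mx, mulmx0, addr0, add0r).
- by rewrite !mul_row_col ?(mul1mx, mulmx1, mul0mx, mulmx0, addr0, add0r).
- by rewrite !mul_row_col ?(mul1mx, mulmx1, mul0mx, mulmx0, addr0, add0r).
- by congr (_, _); rewrite /= !mul_col_row !(mulmx1, mulmx0, mul0mx)
    add_block_mx !(addr0, add0r) -scalar_mx_block.
Qed.

Lemma biprod_unit P Q X Y (i1 : arr P X) (i2 : arr Q X) p1 p2
    (j1 : arr P Y) (j2 : arr Q Y) q1 q2 :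
  biprod i1 i2 p1 p2 -> biprod j1 j2 q1 q2 ->
  (i1 \oa q1 + i2 \oa q2) \oa (j1 \oa p1 + j2 \oa p2) = aone.
Proof.
move=> [_ [a1 a2] a3 a4 a5] [_ [b1 b2] b3 b4 b5].
rewrite acompDl !acompDr !acompA -!(acompA _ q1) -!(acompA _ q2) b1 b2 b3 b4.
by rewrite !acomp0r !acomp1r !acomp0l add0r addr0.
Qed.

Lemma biprod_iso P Q X Y (i1 : arr P X) (i2 : arr Q X) p1 p2
    (j1 : arr P Y) (j2 : arr Q Y) q1 q2 :
  biprod i1 i2 p1 p2 -> biprod j1 j2 q1 q2 -> iso X Y.
Proof.
move=> bX bY; exists (j1 \oa p1 + j2 \oa p2).
  case: bX => -[? ? ? ?] *; case: bY => -[? ? ? ?] *.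
  by apply: hom_add; apply: hom_comp.
by exists (i1 \oa q1 + i2 \oa q2); split; apply: biprod_unit.
Qed.

Lemma biprod_comp P P' Q Q' X (i1 : arr P X) (i2 : arr Q X) p1 p2
  (f : arr P' P) f' (g : arr Q' Q) g' :
  biprod i1 i2 p1 p2 -> hom f -> f' \oa f = aone -> f \oa f' = aone ->
  hom g -> g' \oa g = aone -> g \oa g' = aone ->
  biprod (i1 \oa f) (i2 \oa g) (f' \oa p1) (g' \oa p2).
Proof.
move=> [[? ? ? ?] [e1 e2] e3 e4 e5] hf f1 f2 hg g1 g2.
have hf' := hom_inv hf f1 f2; have hg' := hom_inv hg g1 g2.
split; rewrite ?acompA.
- by split; apply: hom_comp.
- by split; rewrite -(acompA _ _ i1, acompA _ _ i2) ?e1 ?e2 acomp1r.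
- by rewrite -(acompA _ _ i2) e3 acomp0r acomp0l.
- by rewrite -(acompA _ _ i1) e4 acomp0r acomp0l.
- by rewrite -(acompA i1) -(acompA i2) f2 g2 !acomp1r.
Qed.

Lemma pdsum_iso P P' Q Q' :
  iso P P' -> iso Q Q' -> iso (pdsum P Q) (pdsum P' Q').
Proof.
move=> [f hf [f' [f1 f2]]] [g hg [g' [g1 g2]]].
exact: biprod_iso (pdsum_biprod P Q)
  (biprod_comp (pdsum_biprod P' Q') hf f1 f2 hg g1 g2).
Qed.

(* Regrouping [X = P + Y], [Y = Q + R] as [X = Q + (P + R)]. *)
Lemma biprod_CA P Q R X Y Z (i1 : arr P X) (i2 : arr Y X) p1 p2
  (j1 : arr Q Y) (j2 : arr R Y) q1 q2 (k1 : arr P Z) (k2 : arr R Z) r1 r2 :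
  biprod i1 i2 p1 p2 -> biprod j1 j2 q1 q2 -> biprod k1 k2 r1 r2 ->
  biprod (i2 \oa j1) (i1 \oa r1 + i2 \oa j2 \oa r2)
         (q1 \oa p2) (k1 \oa p1 + k2 \oa q2 \oa p2).
Proof.
move=> [[hi1 hi2 hp1 hp2] [e1 e2] e3 e4 e5] [[hj1 hj2 hq1 hq2] [f1 f2] f3 f4 f5].
move=> [[hk1 hk2 hr1 hr2] [g1 g2] g3 g4 g5].
split.
- by split; repeat (apply: hom_add || apply: hom_comp).
- split; first by rewrite acompA -(acompA q1) e2 acomp1r.
  rewrite !acompDl !acompDr !acompA -!(acompA _ p1) -!(acompA _ p2) e1 e3.
  rewrite e4 !acompA -!(acompA _ p2) e2 !acomp0r !acomp0l !acomp1r addr0 add0r.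
  by rewrite -(acompA _ q2) f2 acomp1r.
- rewrite acompDr !acompA -!(acompA _ p2) e4 e2 acomp0r acomp0l acomp1r add0r.
  by rewrite f3 acomp0l.
- rewrite acompDl !acompA -!(acompA _ p2) -!(acompA _ p1) e2 e3 acomp0r acomp0l add0r.
  by rewrite acomp1r -(acompA _ q2) f4 acomp0r.
- rewrite acompDr !acompDl !acompA -!(acompA _ r1) -!(acompA _ r2) g1 g2 g3 g4.
  rewrite !acomp0r !acomp0l !acomp1r addr0 add0r addrCA -e5; congr (_ + _).
  by rewrite -acompDl -!(acompA i2) -acompDr f5 acomp1r.
Qed.

Lemma pdsumCA P Q R : iso (pdsum P (pdsum Q R)) (pdsum Q (pdsum P R)).
Proof.
exact: biprod_iso (biprod_CA (pdsum_biprod _ _) (pdsum_biprod _ _) (pdsum_biprod _ _))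
  (pdsum_biprod _ _).
Qed.

End Biproducts.

(** * Krull-Schmidt theorem *)

Section KrullSchmidt.
Variable F : fieldType.
Implicit Types P Q R S X Y b : pencil F.

(** In a rank factorization [e = C R], cancelling the full-rank outer factors in [C (R C) R = C R]
    leaves [R C = 1]. *)
Lemma idempotent_factor n (e : 'M[F]_n) : e *m e = e ->
  exists (r : nat) (C : 'M[F]_(n, r)) (R : 'M[F]_(r, n)),
    C *m R = e /\ R *m C = 1%:M.
Proof.
move=> ee; exists (\rank e), (col_base e), (row_base e).
split; first exact: mulmx_base.
apply: (row_full_inj (col_base_full e)); apply: (row_free_inj (row_base_free e)).
by rewrite mulmx1 mulmxA -mulmxA mulmx_base ee.
Qed.

(** The complement is the image of the idempotent [1 - f g], split separately on rows and on
    columns; this idempotent commutes with the slices, so they restrict to its image. *)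
Lemma retract_split b S (f : arr b S) (g : arr S b) :
  hom f -> hom g -> g \oa f = aone ->
  exists S' (j : arr S' S) (q : arr S S'), biprod f j g q.
Proof.
move=> hf hg gf.
have [gf1 gf2] := gf.
have idem n k (x : 'M[F]_(n, k)) (y : 'M[F]_(k, n)) : y *m x = 1%:M ->
    (1%:M - x *m y) *m (1%:M - x *m y) = 1%:M - x *m y.
  move=> yx; rewrite mulmxBl mul1mx !mulmxBr mulmx1 !mulmxA -(mulmxA x y x) yx.
  by rewrite mulmx1 subrr subr0.
have [r1 [C1 [R1 [CR1 RC1]]]] := idempotent_factor (idem _ _ _ _ gf1).
have [r2 [C2 [R2 [CR2 RC2]]]] := idempotent_factor (idem _ _ _ _ gf2).
have gC n k r (x : 'M[F]_(n, k)) (y : 'M[F]_(k, n)) (C : 'M_(n, r)) (T : 'M_(r, n)) :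
    y *m x = 1%:M -> C *m T = 1%:M - x *m y -> T *m C = 1%:M ->
    y *m C = 0 /\ T *m x = 0.
  move=> yx CR RC; split.
    by rewrite -[C]mulmx1 -RC mulmxA CR mulmxA mulmxBr mulmx1 mulmxA yx mul1mx subrr mul0mx.
  by rewrite -[T]mul1mx -RC -!mulmxA (mulmxA C) CR mulmxBl mul1mx -mulmxA yx mulmx1 subrr mulmx0.
have [gC1 Rf1] := gC _ _ _ _ _ _ _ gf1 CR1 RC1.
have [gC2 Rf2] := gC _ _ _ _ _ _ _ gf2 CR2 RC2.
have [[hf1 hf2] [hg1 hg2]] := (hf, hg).
pose S' := Pencil (R1 *m ps1 S *m C2) (R1 *m ps2 S *m C2).
exists S', (C1, C2), (R1, R2).
have comm A (B : 'M_(prow b, pcol b)) : f.1 *m B = A *m f.2 -> g.1 *m A = B *m g.2 ->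
    (C1 *m R1) *m A = A *m (C2 *m R2).
  by move=> fA gA; rewrite CR1 CR2 mulmxBl mulmxBr mul1mx mulmx1 -mulmxA gA !mulmxA fA.
have cm1 := comm _ _ hf1 hg1; have cm2 := comm _ _ hf2 hg2.
split.
- split=> //; split=> /=.
  + by rewrite !mulmxA cm1 -!mulmxA RC2 mulmx1.
  + by rewrite !mulmxA cm2 -!mulmxA RC2 mulmx1.
  + by rewrite -!mulmxA -cm1 !mulmxA RC1 mul1mx.
  + by rewrite -!mulmxA -cm2 !mulmxA RC1 mul1mx.
- by split=> //; rewrite /acomp /= RC1 RC2.
- by rewrite /acomp /= gC1 gC2.
- by rewrite /acomp /= Rf1 Rf2.
- by rewrite /acomp /= CR1 CR2; congr (_, _); rewrite /= addrC subrK.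
Qed.

(* The complement of the pivot [q1 f i1] is the Schur complement. *)
Lemma biprod_cancel P Q R S X Y (i1 : arr P X) (i2 : arr R X) p1 p2
    (j1 : arr Q Y) (j2 : arr S Y) q1 q2 (f : arr X Y) :
  biprod i1 i2 p1 p2 -> biprod j1 j2 q1 q2 -> hom f -> unitarr f ->
  unitarr (q1 \oa f \oa i1) -> iso R S.
Proof.
move=> [[hi1 hi2 hp1 hp2] [e1 e2] e3 e4 e5] [[hj1 hj2 hq1 hq2] [f1 f2] f3 f4 f5].
move=> hf [g [gf fg]]; set u := q1 \oa f \oa i1 => -[v [vu uv]].
have hu : hom u by do 2!apply: hom_comp => //.
have hv := hom_inv hu vu uv.
have hg := hom_inv hf gf fg.
have i2p2 : i2 \oa p2 = aone - i1 \oa p1 by rewrite -e5 addrC addKr.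
have j2q2 : j2 \oa q2 = aone - j1 \oa q1 by rewrite -f5 addrC addKr.
exists (q2 \oa f \oa i2 - q2 \oa f \oa i1 \oa v \oa (q1 \oa f \oa i2)).
  by apply: hom_sub; repeat apply: hom_comp.
(* The inverse of the Schur complement is the corresponding corner of the inverse of [f]. *)
exists (p2 \oa g \oa j2); split.
  rewrite acompBr !acompA -!(acompA (p2 \oa g) j2) j2q2 !acompBr acomp1r !acompBl.
  rewrite -!(acompA p2 g f) gf acomp1r e2 e4 acomp0l.
  rewrite !acompA -!(acompA _ f i1) -!(acompA _ q1 (f \oa i1)) (acompA q1) -/u.
  by rewrite -!(acompA _ u v) uv acomp1r !acomp0l sub0r opprK subrK.
rewrite acompBl !acompA -!(acompA _ i2 p2) i2p2 !acompBr !acomp1r !acompBl.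
rewrite -!(acompA q2 f g) -!(acompA _ f g) fg !acomp1r f2 -/u.
rewrite -!(acompA _ q1 j2) f3 acomp0r sub0r !acompA.
rewrite -!(acompA _ q1 f) -!(acompA _ (q1 \oa f) i1) -/u.
rewrite -!(acompA _ v u) vu acomp1r.
by rewrite opprK subrK.
Qed.

(* If [b] does not pivot on [P], it splits off from [S]. *)
Lemma exchange b R P S : local b -> local P -> iso (pdsum b R) (pdsum P S) ->
  (iso b P /\ iso R S) \/
  exists S', iso S (pdsum b S') /\ iso R (pdsum P S').
Proof.
move=> [nzb lb] lP [f hf uf]; have [g [gf fg]] := uf.
have hg := hom_inv hf gf fg.
have bX := pdsum_biprod b R; have bY := pdsum_biprod P S.
have [[hi1 hi2 hp1 hp2] [e1 e2] e3 e4 e5] := bX.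
have [[hj1 hj2 hq1 hq2] [f1 f2] f3 f4 f5] := bY.
set i1 := emb1 b R in hi1 e1 e4 e5 bX; set i2 := emb2 b R in hi2 e2 e3 e5 bX.
set p1 := proj1 b R in hp1 e1 e3 e5 bX; set p2 := proj2 b R in hp2 e2 e4 e5 bX.
set j1 := emb1 P S in hj1 f1 f4 f5 bY; set j2 := emb2 P S in hj2 f2 f3 f5 bY.
set q1 := proj1 P S in hq1 f1 f3 f5 bY; set q2 := proj2 P S in hq2 f2 f4 f5 bY.
(* The identity of [b], which is [p1 g f i1], is the sum of a part [a] through [P] and a part [c]
   through [S]; by locality one of them is invertible. *)
pose a := p1 \oa g \oa j1 \oa (q1 \oa f \oa i1).
pose c := p1 \oa g \oa j2 \oa (q2 \oa f \oa i1).
have ac : aone - a = c.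
  rewrite /a /c !acompA -!(acompA _ j1 q1) -!(acompA _ j2 q2).
  have -> : j2 \oa q2 = aone - j1 \oa q1 by rewrite -f5 addrC addKr.
  by rewrite acompBr acomp1r !acompBl -!(acompA p1 g f) gf acomp1r e1.
have ha1 : hom (q1 \oa f \oa i1) by repeat apply: hom_comp.
have ha2 : hom (p1 \oa g \oa j1) by repeat apply: hom_comp.
have hc1 : hom (q2 \oa f \oa i1) by repeat apply: hom_comp.
have hc2 : hom (p1 \oa g \oa j2) by repeat apply: hom_comp.
have [ua|] := lb a (hom_comp ha2 ha1).
  left; case: (ua) => w [w1 w2].
  have hw := hom_inv (hom_comp ha2 ha1) w1 w2.
  have up : unitarr (q1 \oa f \oa i1).
    apply: (retract_local_unit ha1 (hom_comp hw ha2)) => //.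
    by rewrite -acompA w1.
  by split; [exists (q1 \oa f \oa i1) | exact: (biprod_cancel bX bY hf uf up)].
rewrite ac => -[w [w1 w2]]; right.
have hw := hom_inv (hom_comp hc2 hc1) w1 w2.
pose k := w \oa (p1 \oa g \oa j2).
have hk : hom k by apply: hom_comp.
have kf : k \oa (q2 \oa f \oa i1) = aone by rewrite /k -acompA w1.
have [S' [j [q bS]]] := retract_split hc1 hk kf.
exists S'; split; first exact: biprod_iso bS (pdsum_biprod b S').
(* [P + (b + S')] is regrouped with [b] in front, and [b] is cancelled. *)
apply: (biprod_cancel bX (biprod_CA bY bS (pdsum_biprod P S')) hf uf).
by rewrite -acompA -acompA (acompA q2) kf; apply: unitarr_one.
Qed.

Lemma dsum_rem (I : Type) (den : I -> pencil F) t1 i t2 :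
  iso (dsum (map den (t1 ++ i :: t2))) (pdsum (den i) (dsum (map den (t1 ++ t2)))).
Proof.
elim: t1 => [|j t1 IH] /=; first exact: iso_refl.
exact: iso_trans (pdsum_iso (iso_refl _) IH) (pdsumCA _ _ _).
Qed.

Lemma dsum_perm (I : eqType) (den : I -> pencil F) s t : perm_eq s t ->
  iso (dsum (map den s)) (dsum (map den t)).
Proof.
elim: s t => [|i s IH] t st; first by rewrite perm_sym in st; rewrite (perm_nilP st); apply: iso_refl.
have it : i \in t by rewrite -(perm_mem st) inE eqxx.
case/splitPr: it st => t1 t2; rewrite perm_sym -cat1s perm_catCA /= perm_cons perm_sym => /IH st.
exact: iso_trans (pdsum_iso (iso_refl _) st) (iso_sym (dsum_rem _ _ _ _)).
Qed.

Lemma dsum_eq_iso (I : eqType) (f g : I -> pencil F) (s : seq I) :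
  {in s, forall i, iso (f i) (g i)} -> iso (dsum (map f s)) (dsum (map g s)).
Proof.
elim: s => [|i s IH] fg; first exact: iso_refl.
apply: pdsum_iso; first by apply: fg; rewrite inE eqxx.
by apply: IH => j js; apply: fg; rewrite inE js orbT.
Qed.

Lemma iso_pdsum_pempty P R : iso (pdsum P R) (pempty F) -> ~ local P.
Proof.
move=> /iso_dims [/= r0 c0] [/eqP nz _]; apply: nz.
move/eqP: r0; move/eqP: c0; rewrite !addn_eq0 => /andP[/eqP c0 _] /andP[/eqP r0 _].
by congr (_, _); apply/matrixP => i; case: i; rewrite ?r0 ?c0.
Qed.

Lemma local_summand (I : eqType) (den : I -> pencil F) b R (t : seq I) :
  local b -> {in t, forall j, local (den j)} ->
  iso (pdsum b R) (dsum (map den t)) ->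
  exists t1 j t2, [/\ t = t1 ++ j :: t2, iso b (den j) &
    iso R (dsum (map den (t1 ++ t2)))].
Proof.
move=> lb; elim: t R => [|k t IH] R lt /= bR.
  by case: (iso_pdsum_pempty bR lb).
have lk : local (den k) by apply: lt; rewrite inE eqxx.
have lt' : {in t, forall j, local (den j)}.
  by move=> j jt; apply: lt; rewrite inE jt orbT.
case: (exchange lb lk bR) => [[bk RL]|[S' [LS RS]]].
  by exists [::], k, t.
have [t1 [j [t2 [-> bj SL]]]] := IH S' lt' (iso_sym LS).
exists (k :: t1), j, t2; split=> //.
exact: iso_trans RS (pdsum_iso (iso_refl _) SL).
Qed.

(** Summands are named by elements of an [eqType], so that uniqueness up to isomorphism and order
    becomes [perm_eq] on names. The induction removes the head of [s] together with the summand of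
    [t] that [local_summand] matches with it. *)
Lemma krull_schmidt (I : eqType) (den : I -> pencil F) (s t : seq I) :
  {in s ++ t, forall i, local (den i)} ->
  {in s & t, forall i j, iso (den i) (den j) -> i = j} ->
  iso (dsum (map den s)) (dsum (map den t)) -> perm_eq s t.
Proof.
elim: s t => [|i s IH] t lst inj st.
  case: t st lst {inj} => // j t /iso_sym /= st /(_ j).
  by rewrite inE eqxx => /(_ isT); case/(iso_pdsum_pempty st).
have li : local (den i) by apply: lst; rewrite inE eqxx.
have lt : {in t, forall j, local (den j)}.
  by move=> j jt; apply: lst; rewrite mem_cat jt orbT.
have [t1 [j [t2 [et ij rest]]]] := local_summand li lt st.
rewrite et in inj lst *; have {}ij : i = j.
  by apply: inj; rewrite ?inE ?mem_cat ?eqxx ?inE ?eqxx ?orbT.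
rewrite -ij perm_sym -cat1s perm_catCA /= perm_cons perm_sym.
have sub k : k \in t1 ++ t2 -> k \in t1 ++ j :: t2.
  by rewrite !(mem_cat, inE) => /orP[] ->; rewrite ?orbT.
apply: IH => // [k | k l ks /sub lt'].
  by rewrite mem_cat => /orP[ks|/sub kt]; apply: lst; rewrite mem_cat inE ?ks ?kt ?orbT.
by apply: inj; rewrite ?inE ?ks ?orbT.
Qed.

End KrullSchmidt.

(** * Transposition and substitution of the slices *)

Section TransposeAction.
Variable F : fieldType.
Implicit Types P Q R : pencil F.

Definition tr P := Pencil (ps1 P)^T (ps2 P)^T.

Definition arr_tr P Q (f : arr P Q) : arr (tr Q) (tr P) := (f.2^T, f.1^T).

Lemma trK P : tr (tr P) = P.
Proof. by case: P => m n A1 A2; rewrite /tr /= !trmxK. Qed.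

Lemma hom_tr P Q (f : arr P Q) : hom f -> hom (arr_tr f).
Proof. by move=> [f1 f2]; split; rewrite /= -!trmx_mul ?f1 ?f2. Qed.

Lemma arr_tr_comp P Q R (g : arr Q R) (f : arr P Q) :
  arr_tr (g \oa f) = arr_tr f \oa arr_tr g.
Proof. by rewrite /arr_tr /acomp /= !trmx_mul. Qed.

Lemma arr_tr1 P : arr_tr (@aone _ P) = aone.
Proof. by rewrite /arr_tr /= !trmx1. Qed.

Lemma retract_tr P Q : retract P Q -> retract (tr P) (tr Q).
Proof.
move=> [f [g [hf hg gf]]]; exists (arr_tr g), (arr_tr f).
by split; rewrite -?arr_tr_comp ?gf ?arr_tr1 //; apply: hom_tr.
Qed.

Lemma iso_tr P Q : iso P Q -> iso (tr P) (tr Q).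
Proof.
move=> [f hf [g [gf fg]]]; have hg := hom_inv hf gf fg.
exists (arr_tr g); first exact: hom_tr.
by exists (arr_tr f); rewrite -!arr_tr_comp gf fg !arr_tr1.
Qed.

Lemma local_tr P : local P -> local (tr P).
Proof.
move=> [nz lP]; split.
  apply: contraNneq nz => -[e1 e2]; apply/eqP.
  by congr (_, _); apply: trmx_inj; rewrite trmx1 trmx0.
have un (f : arr P P) (h : arr (tr P) (tr P)) :
    f = (h.2^T, h.1^T) -> unitarr f -> unitarr h.
  move=> -> [g [[a1 a2] [b1 b2]]]; exists (g.2^T, g.1^T).
  by split; congr (_, _); apply: trmx_inj; rewrite trmx_mul trmxK trmx1.
move=> f [hf1 hf2].
have hf' : hom (f.2^T, f.1^T).
  by split; apply: trmx_inj; rewrite /= !trmx_mul !trmxK.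
case: (lP _ hf') => uf; [left | right]; apply: un uf => //.
by congr (_, _); rewrite /= linearB /= trmx1.
Qed.

Definition tact (a b c d : F) P :=
  Pencil (a *: ps1 P + b *: ps2 P) (c *: ps1 P + d *: ps2 P).

Lemma tact_comp a b c d a' b' c' d' P :
  tact a b c d (tact a' b' c' d' P) =
  tact (a * a' + b * c') (a * b' + b * d') (c * a' + d * c') (c * b' + d * d') P.
Proof.
rewrite /tact /=; congr Pencil;
by rewrite !scalerDr !scalerA !scalerDl addrACA.
Qed.

Lemma tact1 P : tact 1 0 0 1 P = P.
Proof. by case: P => m n A B; rewrite /tact /= !scale1r !scale0r addr0 add0r. Qed.

Lemma hom_tact a b c d P Q (f : arr P Q) :
  hom f -> @hom _ (tact a b c d P) (tact a b c d Q) f.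
Proof.
move=> [f1 f2]; split;
by rewrite /= mulmxDl mulmxDr -!scalemxAl -!scalemxAr f1 f2.
Qed.

Lemma cramer (V : lmodType F) (a b c d : F) (x y : V) :
  (a * d - b * c) *: x = d *: (a *: x + b *: y) - b *: (c *: x + d *: y).
Proof.
rewrite !scalerDr !scalerA opprD addrACA [b * d]mulrC subrr addr0.
by rewrite -scalerBl [d * a]mulrC.
Qed.

Lemma tact_hom a b c d P Q (f : arr P Q) : a * d - b * c != 0 ->
  @hom _ (tact a b c d P) (tact a b c d Q) f -> hom f.
Proof.
move=> nz [f1 f2]; move: f1 f2.
rewrite /= !mulmxDl !mulmxDr -!scalemxAl -!scalemxAr.
move=> f1 f2; split; apply: (scalerI nz).
  rewrite (cramer _ _ _ _ (_ *m ps1 P) (f.1 *m ps2 P)) f1 f2.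
  by rewrite (cramer _ _ _ _ (ps1 Q *m _) (ps2 Q *m f.2)).
have -> : a * d - b * c = d * a - c * b by rewrite mulrC [b * c]mulrC.
rewrite (cramer _ _ _ _ (_ *m ps2 P) (f.1 *m ps1 P)).
rewrite (cramer _ _ _ _ (ps2 Q *m _) (ps1 Q *m f.2)).
rewrite [d *: (f.1 *m _) + _]addrC [b *: (f.1 *m _) + _]addrC f1 f2.
by rewrite [d *: _ + _]addrC [b *: (ps2 Q *m _) + _]addrC.
Qed.

Lemma iso_tact a b c d P Q : iso P Q -> iso (tact a b c d P) (tact a b c d Q).
Proof. by move=> [f hf [g e]]; exists f; [exact: hom_tact | exists g]. Qed.

Lemma local_tact a b c d P :
  a * d - b * c != 0 -> local P -> local (tact a b c d P).
Proof. by move=> nz [nz1 lP]; split=> // f /(tact_hom nz) /lP. Qed.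

Lemma tact_pdsum a b c d P Q :
  tact a b c d (pdsum P Q) = pdsum (tact a b c d P) (tact a b c d Q).
Proof.
by rewrite /tact /pdsum /= !scale_block_mx !add_block_mx !scaler0 !addr0.
Qed.

Lemma tact_dsum a b c d (L : seq (pencil F)) :
  tact a b c d (dsum L) = dsum (map (tact a b c d) L).
Proof.
elim: L => [|P L /= <-]; last exact: tact_pdsum.
by rewrite /tact /= !scaler0 !addr0.
Qed.

Lemma sp_sumE m n (A1 A2 : 'M[F]_(m, n)) (R : 'M_m) (S : 'M_n) (T : 'M[F]_2) i' j' k' :
  \sum_(i < m) \sum_(j < n) \sum_(k < 2)
     slice A1 A2 k i j * R i i' * S j j' * T k k' =
  (R^T *m (T 0 k' *: A1 + T 1 k' *: A2) *m S) i' j'.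
Proof.
rewrite exchange_big mxE /=; apply: eq_bigr => j _.
rewrite mxE mulr_suml; apply: eq_bigr => i _.
rewrite !mxE big_ord_recl big_ord1 /slice /= !mulrDr !mulrDl.
have mulAC (x y z t : F) : x * y * z * t = y * (t * x) * z.
  by rewrite mulrAC [x * y]mulrC [t * x]mulrC mulrA.
by rewrite !mulAC; congr (_ * (T _ _ * _) * _ + _ * (T _ _ * _) * _); apply: val_inj.
Qed.

Lemma det_mx2 (T : 'M[F]_2) : \det T = T 0 0 * T 1 1 - T 1 0 * T 0 1.
Proof.
rewrite (expand_det_col _ 0) !big_ord_recl big_ord0 addr0 /cofactor !det_mx11 !mxE /=.
rewrite expr0 expr1 mul1r mulN1r mulrN; congr (_ * _ - _ * _); congr (T _ _);
exact: val_inj.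
Qed.

(** The factors [R] and [S] of an equivalence amount to the isomorphism [(R^T, S^-1)]; only [T]
    changes the slices by a substitution. *)
Lemma pencil_equivP P Q : pencil_equiv P Q <->
  exists a b c d : F, a * d - b * c != 0 /\ iso (tact a b c d P) Q.
Proof.
split.
  case: P Q => m n A1 A2 [m' n' B1 B2] [/= em [en]]; subst m' n'.
  rewrite !castmx_id => -[R [S [T [uR uS uT E]]]].
  (* The new slices are read off the columns of [T], hence the transposed order. *)
  exists (T 0 0), (T 1 0), (T 0 1), (T 1 1); split.
    by move: uT; rewrite unitmxE unitfE det_mx2.
  have E1 : B1 = R^T *m (T 0 0 *: A1 + T 1 0 *: A2) *m S.
    by apply/matrixP=> i j; rewrite -sp_sumE -E.
  have E2 : B2 = R^T *m (T 0 1 *: A1 + T 1 1 *: A2) *m S.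
    by apply/matrixP=> i j; rewrite -sp_sumE -E.
  exists (R^T, invmx S); first by split; rewrite /= ?E1 ?E2 mulmxK.
  exists (invmx R^T, S); rewrite /acomp /= ?mulmxV ?mulVmx ?unitmx_tr //.
move=> [a [b [c [d [nz [f hf uf]]]]]].
case: P Q f hf uf => m n A1 A2 [m' n' B1 B2] f hf uf.
have [/= em en] := unitarr_dims uf; subst m' n'.
case: uf hf => g [[gf1 gf2] [fg1 fg2]] [hf1 hf2].
exists erefl, erefl; rewrite !castmx_id.
pose T : 'M[F]_2 := \matrix_(i, j) if i == 0 then if j == 0 then a else c
                      else if j == 0 then b else d.
have [T00 T10 T01 T11] : [/\ T 0 0 = a, T 1 0 = b, T 0 1 = c & T 1 1 = d].
  by rewrite !mxE.
exists f.1^T, g.2, T; split.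
- by rewrite unitmx_tr; case/mulmx1_unit: gf1.
- by case/mulmx1_unit: gf2.
- by rewrite unitmxE unitfE det_mx2 T00 T11 T10 T01.
move=> i j k; rewrite sp_sumE trmxK /slice.
have [k0|k1] : k = 0 \/ k = 1.
  by case: k => [[|[|]]] // lk; [left | right]; apply: val_inj.
  by rewrite k0 T00 T10 /=; move: hf1 => /= ->; rewrite -mulmxA fg2 mulmx1.
by rewrite k1 T01 T11 /=; move: hf2 => /= ->; rewrite -mulmxA fg2 mulmx1.
Qed.

End TransposeAction.

(** * Endomorphisms of the blocks *)

Section Companion.
Variable F : fieldType.
Implicit Types chi p q : {poly F}.

(* [Phi chi] with the dimension as a free parameter, so that it can be a successor. *)
Definition cmx n chi : 'M[F]_n :=
  \matrix_(i < n, j < n)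
    ((if (j : nat) == n.-1 then - chi`_i else 0) + ((i : nat) == j.+1)%:R).

Lemma blockPhiE n chi : (size chi).-1 = n ->
  blockPhi chi = Pencil 1%:M (cmx n chi).
Proof. by move=> <-. Qed.

Lemma char_poly_tr n (A : 'M[F]_n) : char_poly A^T = char_poly A.
Proof.
rewrite /char_poly -[RHS]det_tr; congr (\det _).
by rewrite /char_poly_mx linearB /= tr_scalar_mx map_trmx.
Qed.

(** [cmx] is the transpose of [companionmx], whose characteristic polynomial is known. *)
Lemma char_poly_cmx n chi : chi \is monic -> (size chi).-1 = n ->
  char_poly (cmx n chi) = chi.
Proof.
move=> mchi <-; rewrite -[RHS](companionmxK mchi) -char_poly_tr; congr char_poly.
apply/matrixP => i j; rewrite !mxE [i.+1 == j]eq_sym.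
case: eqP => [iE|] /=; last by rewrite add0r.
by rewrite iE prednK ?ltn_eqF ?addr0 //; apply: leq_ltn_trans (leq0n i) _.
Qed.

Section Cyclic.
Variables (n : nat) (chi : {poly F}).
Hypotheses (chi_monic : chi \is monic) (chi_size : size chi = n.+2).
Local Notation C := (cmx n.+1 chi).
Local Notation e0 := (delta_mx 0 0 : 'cV[F]_n.+1).

(** So [e0] is a cyclic vector, on which the rest of the section is built. *)
Lemma cmxX (i : 'I_n.+1) : C ^+ i *m e0 = delta_mx i 0.
Proof.
case: i => i; elim: i => [|i IH] lti /=.
  by rewrite expr0 mul1mx; congr delta_mx; apply: val_inj.
rewrite exprS -mulmxE -mulmxA (IH (ltnW lti)) -colE.
apply/colP => k; by rewrite !mxE /= (@ltn_eqF i n) // add0r -val_eqE andbT.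
Qed.

Lemma horner_cmx q : (size q <= n.+1)%N -> horner_mx C q *m e0 = \col_i q`_i.
Proof.
move=> sq; have -> : q = \poly_(i < n.+1) q`_i.
  by apply/polyP => i; rewrite coef_poly; case: ltnP => // ?; rewrite nth_default ?(leq_trans sq).
rewrite poly_def linear_sum mulmx_suml /=; apply/colP => k.
rewrite mxE -poly_def coef_poly ltn_ord summxE (bigD1 k) //= big1 ?addr0.
  by rewrite linearZ /= rmorphXn /= horner_mx_X -scalemxAl cmxX !mxE !eqxx mulr1.
move=> i ik; rewrite linearZ /= rmorphXn /= horner_mx_X -scalemxAl cmxX !mxE.
by rewrite eq_sym (negPf ik) mulr0.
Qed.

Lemma horner_cmx_eq0 q : (horner_mx C q == 0) = (chi %| q).
Proof.
have chi0 : horner_mx C chi = 0.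
  by rewrite -{2}(@char_poly_cmx n.+1 chi) ?chi_size // Cayley_Hamilton.
apply/eqP/idP => [|/dvdpP [r ->]]; last by rewrite rmorphM /= chi0 mulr0.
rewrite {1}(divp_eq q chi) rmorphD rmorphM /= chi0 mulr0 add0r => r0.
rewrite /dvdp -size_poly_eq0 size_poly_eq0; apply/eqP/polyP => i; rewrite coef0.
have sr : (size (q %% chi)%R <= n.+1)%N.
  by rewrite -ltnS -chi_size ltn_modp monic_neq0.
case: (ltnP i n.+1) => [lti|]; last by move=> /(leq_trans sr)/(nth_default _).
by move: (horner_cmx sr); rewrite r0 mul0mx => /colP/(_ (Ordinal lti)); rewrite !mxE.
Qed.

(** A matrix commuting with [C] is determined by its value on the cyclic vector [e0], and that value
    is some [q(C) e0]. *)
Lemma comm_cmx (A : 'M[F]_n.+1) : A *m C = C *m A -> exists q, A = horner_mx C q.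
Proof.
move=> AC; pose q := \poly_(i < n.+1) A (inord i) 0; exists q.
have Ae : A *m e0 = horner_mx C q *m e0.
  rewrite horner_cmx ?size_poly // -colE; apply/colP => i.
  by rewrite !mxE coef_poly ltn_ord inord_val.
have comX i : A *m C ^+ i = C ^+ i *m A by apply: (commrX i AC).
apply/matrixP => i j.
have : A *m delta_mx j 0 = horner_mx C q *m delta_mx j 0 :> 'cV_n.+1.
  rewrite -cmxX !mulmxA comX -mulmxA Ae mulmxA; congr (_ *m _).
  exact/esym/(commrX j (comm_horner_mx q (comm_mx_refl C))).
by rewrite -!colE => /colP/(_ i); rewrite !mxE.
Qed.

End Cyclic.

(** This is the locality of [F[x]/(p^e)], which by [comm_cmx] and [horner_cmx_eq0] is the
    endomorphism ring of [blockPhi chi]. *)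
Lemma irreducible_pow_cases (p chi q : {poly F}) e : irreducible_poly p ->
  chi = p ^+ e -> coprimep q chi \/ coprimep (1 - q) chi.
Proof.
move=> ip ->; have [pq|npq] := boolP (p %| q).
  right; rewrite coprimep_sym; apply: coprimep_expl.
  rewrite irreducible_poly_coprime //; apply/negP => pq1.
  have : p %| 1 by rewrite -(subrK q 1) dvdp_add.
  by rewrite dvdp1; case: ip => /gtn_eqF ->.
by left; rewrite coprimep_sym; apply: coprimep_expl; rewrite irreducible_poly_coprime.
Qed.

Lemma horner_coprime_unit n (A : 'M[F]_n.+1) (q chi : {poly F}) :
  horner_mx A chi = 0 -> coprimep q chi -> horner_mx A q \in unitmx.
Proof.
move=> chi0 /Bezout_coprimepP [[u v] /= uv1].
have : horner_mx A u *m horner_mx A q = (lead_coef (u * q + v * chi))%:M.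
  have /(congr1 (horner_mx A)) := eqp_eq uv1.
  rewrite lead_coef1 scale1r linearZ /= rmorph1 rmorphD !rmorphM /= chi0 mulr0 addr0.
  by rewrite mulmxE => ->; rewrite -scalemx1.
set k := lead_coef _ => E.
have k0 : k != 0.
  by rewrite lead_coef_eq0 -size_poly_gt0 (eqp_size uv1) size_poly1.
have : (k^-1 *: horner_mx A u) *m horner_mx A q = 1%:M.
  by rewrite -scalemxAl E scale_scalar_mx mulVf.
by case/mulmx1_unit.
Qed.

Lemma primary_size chi : primary_monic chi -> exists n, size chi = n.+2.
Proof. by case=> _; case: (size chi) => [|[|n]] // _ _; exists n. Qed.

Lemma local_blockPhi chi : primary_monic chi -> local (blockPhi chi).
Proof.
move=> pchi; have [n sn] := primary_size pchi.
case: pchi => mchi _ [p ip [e chiE]].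
split; first by apply: neq0_aone; rewrite /= sn.
rewrite (@blockPhiE n.+1 chi) ?sn // => -[X Y] [/= ].
rewrite mulmx1 mul1mx => <- /comm_cmx [q ->].
have chi0 : horner_mx (cmx n.+1 chi) chi = 0.
  by apply/eqP; rewrite horner_cmx_eq0.
have [/(horner_coprime_unit chi0) u|/(horner_coprime_unit chi0) u] := irreducible_pow_cases q ip chiE.
  by left; apply: unitarr_endo.
by right; apply: unitarr_endo; move: u; rewrite rmorphB rmorph1.
Qed.

Lemma horner_intertwine n (C D Z : 'M[F]_n.+1) q :
  Z *m C = D *m Z -> Z *m horner_mx C q = horner_mx D q *m Z.
Proof.
move=> ZC; elim/poly_ind: q => [|q c IH]; first by rewrite !rmorph0 mul0mx mulmx0.
rewrite !rmorphD !rmorphM /= !horner_mx_X !horner_mx_C -!mulmxE.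
rewrite mulmxDl mulmxDr -[_ *m D *m Z]mulmxA -ZC !mulmxA IH; congr (_ + _).
by rewrite scalar_mxC.
Qed.

(** As the first slices are 1, an isomorphism is a similarity of companion matrices. Each polynomial
    then annihilates the companion matrix of the other, so the two divide each other. *)
Lemma blockPhi_inj chi eta : primary_monic chi -> primary_monic eta ->
  iso (blockPhi chi) (blockPhi eta) -> chi = eta.
Proof.
move=> pchi peta; have [n sn] := primary_size pchi; have [n' sn'] := primary_size peta.
case: pchi peta => mchi _ _ [meta _ _] ie.
have [/= en _] := iso_dims ie; rewrite sn sn' /= in en; case: en => en; subst n'.
move: ie; rewrite (@blockPhiE n.+1 chi) ?sn // (@blockPhiE n.+1 eta) ?sn' //.
move=> [[X Y] [/= h1 h2] [[X' Y'] [[/= a _] [/= b _]]]].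
have XY : X = Y by rewrite -[X]mulmx1 h1 mul1mx.
subst Y; apply/eqP; rewrite -eqp_monic // /eqp -(horner_cmx_eq0 mchi sn).
rewrite -(horner_cmx_eq0 meta sn').
have conj (C D Z Z' : 'M[F]_n.+1) q : Z *m C = D *m Z -> Z' *m Z = 1%:M ->
    horner_mx D q = 0 -> horner_mx C q = 0.
  move=> ZC ZZ D0; have -> : horner_mx C q = Z' *m horner_mx D q *m Z; last first.
    by rewrite D0 mulmx0 mul0mx.
  have Zu : Z \in unitmx by case/mulmx1_unit: ZZ.
  have -> : Z' = invmx Z by rewrite -[LHS]mulmx1 -(mulmxV Zu) mulmxA ZZ mul1mx.
  by rewrite -mulmxA -(horner_intertwine q ZC) mulKmx.
apply/andP; split; apply/eqP.
  apply: (conj _ (cmx n.+1 eta) X X') => //.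
  by apply/eqP; rewrite horner_cmx_eq0.
have h2' : X' *m cmx n.+1 eta = cmx n.+1 chi *m X'.
  by rewrite -[LHS]mulmx1 -b mulmxA -(mulmxA X') -h2 mulmxA a mul1mx.
apply: (conj _ (cmx n.+1 chi) X' X) => //.
by apply/eqP; rewrite horner_cmx_eq0.
Qed.

End Companion.

(** * Endomorphisms of [(F_r, G_r)] are scalar *)

Section BlockF.
Variable F : fieldType.

(** Compatibility with [F] and [G] makes [Y] constant along diagonals, with zeros in the last column
    above the corner and in the first column below the corner. Every off-diagonal entry lies on a
    diagonal that meets one of these zeros. *)
Lemma endo_blockF r (f : arr (blockF F r.+1) (blockF F r.+1)) : hom f ->
  exists c : F, f = (c%:M, c%:M).
Proof.
case: f => X Y [] /= hF hG; rewrite /= in X Y hF hG *.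
have F1 (i l : 'I_r) : Y (widen_ord (leqnSn r) i) (widen_ord (leqnSn r) l) = X i l.
  have /matrixP/(_ i (widen_ord (leqnSn r) l)) := hF; rewrite !mxE.
  rewrite (bigD1 l) // [RHS](bigD1 (widen_ord (leqnSn r) i)) //= !mxE !eqxx mul1r mulr1.
  rewrite !big1 ?addr0 => [->||] // k; rewrite -val_eqE /= => nk;
    by rewrite !mxE /= /bump ?leq0n ?add1n ?eqSS ?[_ == k :> nat]eq_sym (negPf nk) ?mul0r ?mulr0.
have F2 (i : 'I_r) : Y (widen_ord (leqnSn r) i) ord_max = 0.
  have /matrixP/(_ i ord_max) := hF; rewrite !mxE.
  rewrite [RHS](bigD1 (widen_ord (leqnSn r) i)) //= !mxE !eqxx mul1r.
  rewrite [LHS]big1 => [|k _]; last by rewrite !mxE /= (ltn_eqF (ltn_ord k)) mulr0.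
  rewrite [X in _ + X]big1 ?addr0 => [<- //|k]; rewrite -val_eqE /= => nk.
  by rewrite !mxE /= ?[_ == k :> nat]eq_sym (negPf nk) mul0r.
have G1 (i l : 'I_r) : Y (lift ord0 i) (lift ord0 l) = X i l.
  have /matrixP/(_ i (lift ord0 l)) := hG; rewrite !mxE.
  rewrite (bigD1 l) // [RHS](bigD1 (lift ord0 i)) //= !mxE !eqxx mul1r mulr1.
  rewrite !big1 ?addr0 => [->||] // k; rewrite -val_eqE /= => nk;
    by rewrite !mxE /= /bump ?leq0n ?add1n ?eqSS ?[_ == k :> nat]eq_sym (negPf nk) ?mul0r ?mulr0.
have G2 (i : 'I_r) : Y (lift ord0 i) ord0 = 0.
  have /matrixP/(_ i ord0) := hG; rewrite !mxE.
  rewrite [RHS](bigD1 (lift ord0 i)) //= !mxE !eqxx mul1r.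
  rewrite [LHS]big1 => [|k _]; last by rewrite !mxE /=  mulr0.
  rewrite [X in _ + X]big1 ?addr0 => [<- //|k]; rewrite -val_eqE /= => nk.
  by rewrite !mxE /= ?[_ == k :> nat]eq_sym (negPf nk) mul0r.
(* Natural number indices allow inductions along the diagonals. *)
pose y (p q : nat) := Y (inord p) (inord q).
have shift p q : (p < r)%N -> (q < r)%N -> y p.+1 q.+1 = y p q.
  move=> lp lq; have := G1 (Ordinal lp) (Ordinal lq); rewrite -F1 /y.
  move=> E; rewrite -[RHS](_ : Y (widen_ord (leqnSn r) (Ordinal lp)) (widen_ord (leqnSn r) (Ordinal lq)) = _).
    by rewrite -E; congr (Y _ _); apply: val_inj; rewrite /= inordK.
  by congr (Y _ _); apply: val_inj; rewrite /= inordK // ltnW.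
have yr p : (p < r)%N -> y p r = 0.
  move=> lp; rewrite -(F2 (Ordinal lp)); congr (Y _ _); apply: val_inj;
  by rewrite /= inordK // ltnW.
have y0 p : (p < r)%N -> y p.+1 0 = 0.
  move=> lp; rewrite -(G2 (Ordinal lp)); congr (Y _ _); apply: val_inj;
  by rewrite /= inordK.
have diag p : (p <= r)%N -> y p p = y 0 0.
  by elim: p => // p IH lp; rewrite shift ?IH // ltnW.
have low p q : (q < p)%N -> (p <= r)%N -> y p q = 0.
  elim: q p => [|q IH] [|p] // lqp lp; first exact: y0.
  by rewrite shift ?IH ?(ltnW lp) //; apply: ltn_trans lp.
have up d p q : (p < q)%N -> (q + d = r)%N -> y p q = 0.
  elim: d p q => [|d IH] p q lpq E; first by rewrite addn0 in E; rewrite E in lpq *; apply: yr.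
  have qr : (q < r)%N by rewrite -E addnS ltnS leq_addr.
  by rewrite -shift ?IH ?addSnnS // (ltn_trans lpq).
have YE : Y = (y 0 0)%:M.
  apply/matrixP => i j; rewrite !mxE -[i in LHS]inord_val -[j in LHS]inord_val -/(y i j).
  have ri := leq_ord i; have rj := leq_ord j.
  have [ij|ij|/val_inj ->] := ltngtP i j; last by rewrite diag // eqxx.
    by rewrite (up (r - j)%N) ?subnKC // -val_eqE (ltn_eqF ij).
  by rewrite low // -val_eqE (gtn_eqF ij).
exists (y 0 0); congr (_, _) => //.
by apply/matrixP => i l; rewrite -F1 YE !mxE -!val_eqE.
Qed.

Lemma local_blockF r : (0 < r)%N -> local (blockF F r).
Proof.
case: r => // r _; split; first by apply: neq0_aone; rewrite /= addnS.
move=> f /endo_blockF [c ->]; have [->|c0] := eqVneq c 0.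
  right; exists aone; rewrite acomp1l acomp1r.
  by rewrite -[aone in RHS]subr0; split; congr (_ - (_, _)); rewrite raddf0.
left; exists (c^-1%:M, c^-1%:M).
by split; congr (_, _); rewrite /= mul_scalar_mx scale_scalar_mx ?mulVf ?mulfV.
Qed.

Lemma local_blockFT r : (0 < r)%N -> local (blockFT F r).
Proof. by move=> r0; exact: (local_tr (local_blockF r0)). Qed.

End BlockF.

(** * Existence of a block summand *)

Section Regular.
Variable F : fieldType.
Implicit Types p q r chi : {poly F}.

(* Irreducibility over an arbitrary field is undecidable, hence the appeal to [classic]. *)
Lemma irreducible_factor q : (1 < size q)%N ->
  exists2 p, irreducible_poly p & p %| q.
Proof.
have [n] := ubnP (size q); elim: n q => // n IH q sqn sq.
have [iq|niq] := classic (irreducible_poly q); first by exists q.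
have [d [sd dq ndq]] : exists d : {poly F}, [/\ size d != 1%N, d %| q & ~~ (d %= q)].
  apply: NNPP => nd; apply: niq; split=> // d sd dq; apply/negPn/negP => ndq.
  by apply: nd; exists d.
have q0 : q != 0 by rewrite -size_poly_gt0 (ltn_trans _ sq).
have d0 : d != 0 by apply: contraNneq q0 => d0; rewrite d0 dvd0p in dq.
have sdq : (size d < size q)%N.
  by rewrite ltn_neqAle dvdp_leq // andbT dvdp_size_eqp.
have s1d : (1 < size d)%N.
  by rewrite ltn_neqAle eq_sym sd size_poly_gt0.
have [||p ip pd] := IH d => //; first exact: leq_trans sdq _.
by exists p => //; apply: dvdp_trans dq.
Qed.

Lemma prime_part p q : irreducible_poly p -> q != 0 ->
  exists e h, q = p ^+ e * h /\ coprimep p h.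
Proof.
move=> ip; have [n] := ubnP (size q); elim: n q => // n IH q sqn q0.
have [/dvdpP [h qE]|npq] := boolP (p %| q); last first.
  by exists 0%N, q; rewrite expr0 mul1r irreducible_poly_coprime.
have h0 : h != 0 by apply: contraNneq q0 => h0; rewrite qE h0 mul0r.
have [||e [k [hE cop]]] := IH h => //.
  apply: leq_trans (ltnSE sqn); rewrite qE size_mul ?(irredp_neq0 ip) //.
  by case: ip => sp _; case: (size p) sp => [|[|m]] // _; rewrite !addnS ltnS leq_addr.
by exists e.+1, k; rewrite exprS -mulrA -hE mulrC.
Qed.

Definition krylov n (C : 'M[F]_n.+1) k (v : 'cV[F]_n.+1) : 'M[F]_(n.+1, k) :=
  \matrix_(i, j) (C ^+ j *m v) i 0.

Lemma horner_mx_mulE n (C : 'M[F]_n.+1) q m (v : 'cV_n.+1) : (size q <= m)%N ->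
  horner_mx C q *m v = \sum_(l < m) q`_l *: (C ^+ l *m v).
Proof.
move=> sq; rewrite {1}(_ : q = \poly_(l < m) q`_l).
  rewrite poly_def linear_sum mulmx_suml; apply: eq_bigr => l _.
  by rewrite linearZ /= rmorphXn /= horner_mx_X -scalemxAl.
by apply/polyP => l; rewrite coef_poly; case: ltnP => // ?; rewrite nth_default ?(leq_trans sq).
Qed.

Lemma krylovE n (C : 'M[F]_n.+1) k v i j :
  krylov C k v i j = (C ^+ j *m v) i 0.
Proof. by rewrite mxE. Qed.

Lemma krylov_mul n (C : 'M[F]_n.+1) k v (z : 'cV_k) :
  krylov C k v *m z =
  horner_mx C (\poly_(i < k) (if insub i is Some j then z j 0 else 0)) *m v.
Proof.
rewrite (horner_mx_mulE _ _ (size_poly _ _)); apply/colP => i.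
rewrite mxE summxE; apply: eq_bigr => j _.
by rewrite krylovE coef_poly ltn_ord valK [RHS]mxE mulrC.
Qed.

Lemma krylov_cmx n (C : 'M[F]_n.+1) k v chi : chi \is monic -> size chi = k.+2 ->
  horner_mx C chi *m v = 0 -> C *m krylov C k.+1 v = krylov C k.+1 v *m cmx k.+1 chi.
Proof.
move=> mchi schi chi0; apply/matrixP => i j.
have -> : (C *m krylov C k.+1 v) i j = (C ^+ j.+1 *m v) i 0.
  rewrite exprS -mulmxE -mulmxA [LHS]mxE [RHS]mxE; apply: eq_bigr => l _.
  by rewrite [in LHS]mxE.
rewrite [RHS]mxE; under [RHS]eq_bigr => l _ do rewrite krylovE [cmx _ _ _ _]mxE mulrDr.
rewrite big_split /=; have [jk|jk] := eqVneq (j : nat) k; last first.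
  have lj : (j.+1 < k.+1)%N by rewrite ltnS ltn_neqAle jk -ltnS /=.
  rewrite [X in X + _]big1 ?add0r => [|l _]; last by rewrite mulr0.
  rewrite (bigD1 (Ordinal lj)) //= eqxx mulr1 big1 ?addr0 // => l.
  by rewrite -val_eqE /= => /negPf ->; rewrite mulr0.
rewrite [X in _ + X]big1 ?addr0 => [|l _]; last first.
  by rewrite jk ltn_eqF ?mulr0.
(* In the last column, [chi(C) v = 0] expresses [C^(k+1) v] through the lower powers, [chi] being
   monic. *)
rewrite jk; move/colP/(_ i): chi0; rewrite [RHS]mxE.
rewrite (horner_mx_mulE _ _ (eq_leq schi)) summxE big_ord_recr /=.
have -> : chi`_k.+1 = 1 by move/monicP: mchi; rewrite lead_coefE schi.
rewrite scale1r => /eqP; rewrite addrC addr_eq0 => /eqP ->.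
rewrite -sumrN; apply: eq_bigr => l _.
by rewrite [in LHS]mxE mulrN mulrC.
Qed.

Lemma horner_mx_tr n (C : 'M[F]_n.+1) q : horner_mx C^T q = (horner_mx C q)^T.
Proof.
elim/poly_ind: q => [|q c IH]; first by rewrite !rmorph0 trmx0.
rewrite !rmorphD !rmorphM /= !horner_mx_X !horner_mx_C IH linearD /= tr_scalar_mx.
congr (_ + _); rewrite -!mulmxE trmx_mul.
by have /(congr1 trmx) := comm_horner_mx q (comm_mx_refl C); rewrite !trmx_mul.
Qed.

(* With [mxminpoly C = p^e h], the Krylov space of [v] is a copy of [F[x]/(p^e)];
   it splits off because the Hankel matrix [f C^(i+j) v] is invertible. *)
Lemma phi_retract n (C : 'M[F]_n.+1) : exists chi,
  primary_monic chi /\ retract (blockPhi chi) (Pencil 1%:M C).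
Proof.
have smp : (1 < size (mxminpoly C))%N by rewrite size_mxminpoly ltnS mxminpoly_nonconstant.
have [p0 ip0 pm0] := irreducible_factor smp.
pose p : {poly F} := (lead_coef p0)^-1 *: p0.
have lp0 : (lead_coef p0)^-1 != 0 by rewrite invr_eq0 lead_coef_eq0 irredp_neq0.
have pp0 : p %= p0 by rewrite eqp_scale.
have mp : p \is monic by rewrite monicE lead_coefZ mulVf // -invr_eq0.
have ip : irreducible_poly p.
  case: ip0 => s i; split; first by rewrite (eqp_size pp0).
  by move=> q sq; rewrite (eqp_dvdr _ pp0) (eqp_rtrans pp0); apply: i.
have pm : p %| mxminpoly C by rewrite (eqp_dvdl _ pp0).
have [[|e] [h [mE cop]]] := prime_part ip (monic_neq0 (mxminpoly_monic C)).
  by move: pm; rewrite mE expr0 mul1r => ph; rewrite irreducible_poly_coprime // ph in cop.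
pose chi : {poly F} := p ^+ e.+1.
have mchi : chi \is monic by apply: monic_exp.
have schi1 : (1 < size chi)%N.
  by rewrite (leq_trans ip.1) // dvdp_leq ?monic_neq0 // /chi exprS dvdp_mulIl.
have pchi : primary_monic chi by split=> //; exists p => //; exists e.+1.
have [k schi] := primary_size pchi.
have C0 : horner_mx C (chi * h) = 0 by rewrite -mE mx_root_minpoly.
(* [p^e h] is a proper divisor of the minimal polynomial [p^(e+1) h]. *)
have [u u0] : exists u : 'cV_n.+1, horner_mx C (p ^+ e * h) *m u != 0.
  have : horner_mx C (p ^+ e * h) != 0.
    rewrite -dvd_mxminpoly mE exprS -mulrA; apply/negP => /dvdp_leq.
    have ph0 : p ^+ e * h != 0.
      by move: (monic_neq0 (mxminpoly_monic C)); rewrite mE exprS -mulrA mulf_eq0 => /norP[].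
    move/(_ ph0); rewrite size_mul ?(monic_neq0 mp) //.
    by case: ip => sp _; case: (size p) sp => [|[|m]] // _; rewrite addSn /= addSn ltnNge leq_addl.
  move/matrix0Pn => [i [j nz]]; exists (delta_mx j 0); rewrite -colE.
  by apply/matrix0Pn; exists i, 0; rewrite mxE.
pose v := horner_mx C h *m u; pose w := horner_mx C (p ^+ e) *m v.
have w0 : w != 0 by rewrite /w /v mulmxA mulmxE -rmorphM.
have pw : horner_mx C p *m w = 0.
  by rewrite /w /v !mulmxA !mulmxE -!rmorphM /= -exprS -/chi C0 mul0mx.
(* [p(C)] kills [w] and [h] is prime to [p], so [h(C)] cannot kill [w]. *)
have hw : horner_mx C h *m w != 0.
  apply: contraNneq w0 => hw.
  have /Bezout_coprimepP [[s t] /= st] := cop.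
  have := eqp_eq st; rewrite lead_coef1 scale1r => /(congr1 (fun q => horner_mx C q *m w)).
  rewrite /= linearZ /= rmorph1 rmorphD !rmorphM /= -!mulmxE mulmxDl -!mulmxA pw hw.
  rewrite !mulmx0 addr0 -scalemxAl mul1mx => /esym/eqP; rewrite scaler_eq0 lead_coef_eq0.
  by rewrite -size_poly_eq0 (eqp_size st) size_poly1.
have /matrix0Pn [i [j hwi]] := hw; rewrite (ord1 j) in hwi.
(* A row of [h(C)] is a functional annihilated by [chi], and this row does not vanish on [w]. *)
pose f := row i (horner_mx C h).
have fw : f *m w != 0.
  by apply/matrix0Pn; exists 0, 0; rewrite -row_mul mxE.
have vchi : horner_mx C chi *m v = 0 by rewrite /v mulmxA mulmxE -rmorphM /= C0 mul0mx.
have fchi : horner_mx C^T chi *m f^T = 0.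
  rewrite horner_mx_tr -trmx_mul /f -row_mul mulmxE -rmorphM /= mulrC C0.
  by rewrite row0 trmx0.
pose Y := krylov C k.+1 v; pose K := (krylov C^T k.+1 f^T)^T.
pose D := cmx k.+1 chi.
have CY : C *m Y = Y *m D by apply: krylov_cmx.
have KC : K *m C = D^T *m K.
  by apply: trmx_inj; rewrite !trmx_mul !trmxK; apply: krylov_cmx.
pose H := K *m Y.
(* A kernel vector of [H] is a polynomial [q] of degree below that of [chi] with [f r(C) q(C) v = 0]
   for all [r]. If [q] is nonzero, some [r] makes [r q] a nonzero multiple of [p^e] modulo [chi],
   whence [f w = 0], a contradiction. *)
have uH : H \in unitmx.
  rewrite -unitmx_tr -row_free_unit; apply: inj_row_free => z /(congr1 trmx).
  rewrite trmx_mul trmxK trmx0 /H -mulmxA krylov_mul.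
  set q := \poly_(i < _) _ => Kq.
  have [q0|q0] := eqVneq q 0.
    apply/rowP => l; have /polyP/(_ l) := q0; rewrite coef_poly ltn_ord coef0 valK.
    by rewrite !mxE.
  have sq : (size q < size chi)%N by rewrite schi ltnS size_poly.
  (* The rows of [K] give this for [r] of degree at most [k]; the others reduce to these modulo
     [chi], since [chi(C) v = 0]. *)
  have fq r : f *m horner_mx C r *m (horner_mx C q *m v) = 0.
    rewrite (divp_eq r chi) rmorphD rmorphM /= mulmxDr mulmxDl.
    have qC a b : horner_mx C a *m horner_mx C b = horner_mx C b *m horner_mx C a.
      by rewrite !mulmxE -!rmorphM mulrC.
    rewrite -mulmxE -!(mulmxA f) -!(mulmxA (horner_mx C (r %/ chi))).
    rewrite [horner_mx C chi *m _]mulmxA qC -(mulmxA _ _ v) vchi !mulmx0 add0r.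
    set r' := r %% chi; have -> : f *m (horner_mx C r' *m (horner_mx C q *m v)) =
        (krylov C^T k.+1 f^T *m (\col_(l < k.+1) r'`_l))^T *m (horner_mx C q *m v).
      rewrite krylov_mul trmx_mul trmxK horner_mx_tr trmxK mulmxA; congr (_ *m horner_mx C _ *m _).
      apply/polyP => l; rewrite coef_poly; case: ltnP => [lk|kl].
        by rewrite insubT mxE.
      rewrite nth_default // (leq_trans _ kl) // -ltnS -schi ltn_modp monic_neq0 //.
    by rewrite trmx_mul -mulmxA Kq mulmx0.
  have [a [g [qE copg]]] := prime_part ip q0.
  have ae : (a <= e)%N.
    rewrite leqNgt; apply/negP => ea; move: sq; apply/negP; rewrite -leqNgt.
    by apply: dvdp_leq => //; rewrite qE dvdp_mulr // dvdp_exp2l.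
  (* With [q = p^a g], the factor [t] inverts [g] modulo [chi] up to a scalar, so [r = p^(e-a) t] is
     the required multiplier. *)
  have /Bezout_coprimepP [[s t] /= st] := coprimep_expl e.+1 copg.
  have := eqp_eq st; rewrite lead_coef1 scale1r.
  set c := lead_coef _ => /(congr1 (fun x => f *m horner_mx C (p ^+ e * x) *m v)).
  have -> : p ^+ e * (s * p ^+ e.+1 + t * g) = p ^+ (e - a) * t * q + (p ^+ e * s) * chi.
    by rewrite qE mulrDr addrC mulrACA -exprD subnK // [p ^+ e * (s * _)]mulrA.
  rewrite rmorphD !(rmorphM _ _ chi) !(rmorphM _ _ q) /= -!mulmxE mulmxDr mulmxDl.
  rewrite -!mulmxA vchi !mulmx0 addr0 (mulmxA f) fq.
  rewrite -scalerAr mulr1 linearZ /= -scalemxAl -scalemxAr => /esym/eqP.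
  rewrite scaler_eq0 (negPf fw) orbF /c lead_coef_eq0.
  by rewrite -size_poly_eq0 (eqp_size st) size_poly1.
exists chi; split=> //; rewrite (@blockPhiE _ k.+1) ?schi //.
have HD : H *m D = D^T *m H by rewrite /H -mulmxA -CY mulmxA KC mulmxA.
have KD : invmx H *m K *m C = D *m (invmx H *m K).
  rewrite -mulmxA KC; apply: (can_inj (mulKmx uH)).
  by rewrite mulKVmx // !mulmxA HD mulmxK.
(* [K] intertwines [C] with [D^T] rather than [D]; as [H D = D^T H], the factor [invmx H] corrects
   this and also makes the composite with [Y] equal to 1. *)
exists (Y, Y), (invmx H *m K, invmx H *m K).
split; first by split; rewrite /= ?mulmx1 ?mul1mx.
  by split; rewrite /= ?mulmx1 ?mul1mx.
by rewrite /acomp /= -mulmxA -/H mulVmx.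
Qed.

Lemma regular_retract (P : pencil F) : (0 < prow P)%N -> prow P = pcol P ->
  \rank (ps1 P) = pcol P ->
  exists chi, primary_monic chi /\ retract (blockPhi chi) P.
Proof.
case: P => m n A1 A2 /= m0 en; subst n; case: m m0 A1 A2 => // m _ A1 A2 rA.
have uA : A1 \in unitmx by rewrite -row_free_unit /row_free rA.
have [chi [pchi rchi]] := phi_retract (invmx A1 *m A2).
exists chi; split=> //; apply: retract_trans rchi _; apply: iso_retract.
exists (A1, 1%:M); first by split; rewrite /= ?mulmx1 // mulKVmx.
by exists (invmx A1, 1%:M); rewrite /acomp /= mulVmx // mulmxV // mulmx1.
Qed.

End Regular.

(** * Reduction modulo the kernel of the first slice *)

Section Extension.
Variable F : fieldType.
Implicit Types P Q b : pencil F.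

(** When [ps1 Q] and [L] are jointly injective, the [k] new columns span [ker A] and the [k] new
    rows [B (ker A)]. Then [Q] is the quotient pencil and [L] the component of [A] into
    [B (ker A)]. *)
Definition plus k Q (L : 'M[F]_(k, pcol Q)) : pencil F :=
  Pencil (block_mx (ps1 Q) 0 L (0 : 'M_k)) (block_mx (ps2 Q) 0 0 (1%:M : 'M_k)).

(** The second slice fixes the lower blocks of the column part. The first slice leaves the single
    equation [D *m ps1 P + E *m L = M *m f.2], which [G] solves. *)
Lemma plus_lift P Q h k (L : 'M[F]_(h, pcol P)) (M : 'M[F]_(k, pcol Q)) (f : arr P Q) G :
  hom f -> G *m col_mx (ps1 P) L = 1%:M ->
  exists D E, @hom _ (plus L) (plus M)
    (block_mx f.1 0 D E, block_mx f.2 0 (D *m ps2 P) E).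
Proof.
move=> [f1 f2] GL; pose DE := M *m f.2 *m G; exists (lsubmx DE), (rsubmx DE).
have DEL : lsubmx DE *m ps1 P + rsubmx DE *m L = M *m f.2.
  by rewrite -mul_row_col hsubmxK -mulmxA GL mulmx1.
split; rewrite /= !mulmx_block !(mul0mx, mulmx0, mulmx1, mul1mx, addr0, add0r).
  by rewrite f1 DEL.
by rewrite f2.
Qed.

(* The composite of the two lifts is [1] on [b]; the kernel vectors [v] force it
   to be unipotent. *)
Lemma plus_retract b Q h k (lam : 'M[F]_(h, pcol b)) (L : 'M[F]_(k, pcol Q)) v G H :
  G *m col_mx (ps1 b) lam = 1%:M -> H *m col_mx (ps1 Q) L = 1%:M ->
  ps1 b *m v = 0 -> lam *m v = 1%:M ->
  retract b Q -> retract (plus lam) (plus L).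
Proof.
move=> Gb HQ bv lv [f [g [hf hg [gf1 gf2]]]].
have [D [E hf']] := plus_lift L hf Gb; have [D' [E' hg']] := plus_lift lam hg HQ.
apply: (retract_unit hf' hg').
move: (hom_comp hg' hf') => [+ _].
rewrite /acomp /= !mulmx_block !(mul0mx, mulmx0, mulmx1, mul1mx, addr0, add0r) gf1 gf2.
rewrite !mul1mx => /eq_block_mx [_ _ e _].
have {e} eE : E' *m E = 1%:M.
  move/(congr1 (mulmx^~ v)): e; rewrite mulmxDl -!mulmxA bv lv mulmx0 add0r.
  by rewrite !mulmx1 mul1mx lv.
by rewrite eE; apply: unitarr_endo; rewrite unitmxE det_lblock !det1 mulr1 unitr1.
Qed.

Lemma inj_left_inv m n (A : 'M[F]_(m, n)) :
  (forall v : 'cV_n, A *m v = 0 -> v = 0) -> exists G, G *m A = 1%:M.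
Proof.
move=> inj; have /row_freeP [B AB] : row_free A^T.
  apply: inj_row_free => v vA; apply: trmx_inj; rewrite trmx0; apply: inj.
  by rewrite -[A]trmxK -trmx_mul vA trmx0.
by exists B^T; apply: trmx_inj; rewrite trmx_mul trmxK trmx1.
Qed.

Lemma left_inv_or_ker m n (A : 'M[F]_(m, n)) :
  (exists G, G *m A = 1%:M) \/ exists2 v : 'cV_n, v != 0 & A *m v = 0.
Proof.
have [e|ne] := classic (exists2 v : 'cV_n, v != 0 & A *m v = 0); [by right | left].
apply: inj_left_inv => v Av; apply/eqP/negPn/negP => v0.
by apply: ne; exists v.
Qed.

(* [V = ker e + im e] for [e = N E B], and likewise [W] for [B N E]. *)
Lemma plus_normal_form P : (\rank (ps1 P) < pcol P)%N ->
  (exists2 v : 'cV_(pcol P), v != 0 & ps1 P *m v = 0 /\ ps2 P *m v = 0) \/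
  exists k Q (L : 'M_(k, pcol Q)) G,
    [/\ (0 < k)%N, G *m col_mx (ps1 Q) L = 1%:M & iso (plus L) P].
Proof.
case: P => m n A B /= rA.
pose K := kermx A^T; pose k := \rank K; pose N := (row_base K)^T.
have k0 : (0 < k)%N by rewrite /k mxrank_ker mxrank_tr subn_gt0.
have AN : A *m N = 0.
  apply: trmx_inj; rewrite trmx_mul trmxK trmx0; apply/sub_kermxP.
  by rewrite eq_row_base.
have kerN v : A *m v = 0 -> exists z : 'cV_k, v = N *m z.
  move=> Av; have /submxP [z zE] : (v^T <= row_base K)%MS.
    by rewrite eq_row_base; apply/sub_kermxP; rewrite -trmx_mul Av trmx0.
  by exists z^T; apply: trmx_inj; rewrite trmx_mul !trmxK.
have Ninj (z : 'cV_k) : N *m z = 0 -> z = 0.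
  move=> Nz; apply: trmx_inj; apply: (row_free_inj (row_base_free K)).
  by apply: trmx_inj; rewrite trmx0 mul0mx trmx_mul trmxK Nz trmx0.
(* Either [B] kills some vector of [ker A], or [B] is injective on [ker A] with left inverse [E]. *)
have [[E EBN]|[z z0 BNz]] := left_inv_or_ker (B *m N); last first.
  left; exists (N *m z); first by apply: contraNneq z0 => /Ninj ->.
  by rewrite !mulmxA AN mul0mx BNz.
right.
have idV : (1%:M - N *m E *m B) *m (1%:M - N *m E *m B) = 1%:M - N *m E *m B.
  rewrite mulmxBl mul1mx mulmxBr mulmx1 -!mulmxA (mulmxA B) (mulmxA E (B *m N)) EBN.
  by rewrite mul1mx subrr subr0.
have idW : (1%:M - B *m N *m E) *m (1%:M - B *m N *m E) = 1%:M - B *m N *m E.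
  rewrite mulmxBl mul1mx mulmxBr mulmx1 -!mulmxA (mulmxA B) (mulmxA E (B *m N)) EBN.
  by rewrite mul1mx !mulmxA subrr subr0.
have [n' [CV [RV [CRV RCV]]]] := idempotent_factor idV.
have [m' [CW [RW [CRW RCW]]]] := idempotent_factor idW.
(* The complement of [ker A] is chosen as [ker (E B)], which [B] maps into the complement [ker E] of
   [B (ker A)]; this makes the second slice block diagonal. *)
have EBC : E *m B *m CV = 0.
  rewrite -[CV]mulmx1 -RCV (mulmxA CV) CRV mulmxA mulmxBr mulmx1 !mulmxA.
  by rewrite -(mulmxA E B N) EBN mul1mx subrr mul0mx.
have RN : RV *m N = 0.
  rewrite -[RV]mul1mx -RCV -!mulmxA (mulmxA CV) CRV mulmxBl mul1mx -!mulmxA EBN.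
  by rewrite mulmx1 subrr mulmx0.
have RBN : RW *m (B *m N) = 0.
  rewrite -[RW]mul1mx -RCW -!mulmxA (mulmxA CW) CRW mulmxBl mul1mx -!mulmxA EBN.
  by rewrite mulmx1 subrr mulmx0.
have EC : E *m CW = 0.
  rewrite -[CW]mulmx1 -RCW (mulmxA CW) CRW mulmxA mulmxBr mulmx1 !mulmxA.
  by rewrite -(mulmxA E B N) EBN mul1mx subrr mul0mx.
pose Q := Pencil (RW *m A *m CV) (RW *m B *m CV).
pose L : 'M_(k, pcol Q) := E *m A *m CV.
have UV : row_mx CV N *m col_mx RV (E *m B) = 1%:M.
  by rewrite mul_row_col CRV mulmxA subrK.
have VU : col_mx RV (E *m B) *m row_mx CV N = 1%:M.
  by rewrite mul_col_row RCV RN EBC -mulmxA EBN -scalar_mx_block.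
have UW : row_mx CW (B *m N) *m col_mx RW E = 1%:M.
  by rewrite mul_row_col CRW subrK.
have WU : col_mx RW E *m row_mx CW (B *m N) = 1%:M.
  by rewrite mul_col_row RCW RBN EC EBN -scalar_mx_block.
have [G GL] : exists G, G *m col_mx (ps1 Q) L = 1%:M.
  (* If [A] kills a vector of the complement of [ker A], that vector is 0. *)
  apply: inj_left_inv => x.
  have -> : col_mx (ps1 Q) L = col_mx RW E *m (A *m CV) by rewrite mul_col_mx !mulmxA.
  move=> /(congr1 (mulmx (row_mx CW (B *m N)))); rewrite !mulmxA UW mul1mx mulmx0.
  rewrite -mulmxA => /kerN [z zE].
  have z0 : z = 0 by rewrite -[z]mul1mx -EBN -!mulmxA -zE !mulmxA EBC mul0mx.
  by rewrite -[x]mul1mx -RCV -mulmxA zE z0 !mulmx0.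
exists k, Q, L, G; split=> //.
exists (row_mx CW (B *m N), row_mx CV N); last first.
  by exists (col_mx RW E, col_mx RV (E *m B)); rewrite /acomp /= UV VU UW WU.
split; rewrite /= mul_row_block !mul_mx_row.
  rewrite !mulmx0 addr0 AN /L; congr row_mx.
  by rewrite -[A in RHS]mul1mx -UW mul_row_col !mulmxDl !mulmxA.
rewrite !mulmx0 mulmx1 addr0 add0r; congr row_mx.
by rewrite !mulmxA CRW !mulmxBl mul1mx -!mulmxA (mulmxA E) EBC !mulmx0 subr0.
Qed.

End Extension.

(** * The induction that finds a block *)

Section ExistsBlock.
Variable F : fieldType.
Implicit Types P Q b : pencil F.

Definition Nmx l : 'M[F]_l := \matrix_(i, j) ((i : nat) == j.+1)%:R.

Definition blockJ l : pencil F := Pencil (Nmx l) 1%:M.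

Definition is_block b : Prop :=
  [\/ exists r, b = blockF F r.+1, exists r, b = blockFT F r.+1,
      exists2 chi, primary_monic chi & b = blockPhi chi |
      exists l, b = blockJ l.+1].

Lemma pencil_eq P Q (er : prow P = prow Q) (ec : pcol P = pcol Q) :
  (forall i j, ps1 P i j = ps1 Q (cast_ord er i) (cast_ord ec j)) ->
  (forall i j, ps2 P i j = ps2 Q (cast_ord er i) (cast_ord ec j)) -> P = Q.
Proof.
case: P Q er ec => m n A B [m' n' A' B'] /= er ec; subst m' n' => eA eB.
by congr Pencil; apply/matrixP => i j; rewrite ?eA ?eB !cast_ord_id.
Qed.

Lemma sum_select n (j0 : 'I_n) (c : pred 'I_n) (x : 'I_n -> F) :
  (forall j, c j = (j == j0)) -> \sum_j (c j)%:R * x j = x j0.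
Proof.
move=> cE; rewrite (bigD1 j0) //= big1 ?addr0 ?cE ?eqxx ?mul1r // => j nj.
by rewrite cE (negPf nj) mul0r.
Qed.

Lemma plus0 b (lam : 'M[F]_(0, pcol b)) : plus lam = b.
Proof.
have er : prow (plus lam) = prow b by rewrite /= addn0.
have ec : pcol (plus lam) = pcol b by rewrite /= addn0.
by apply: (pencil_eq (er := er) (ec := ec)) => i j /=;
  case: (split_ordP i) => [i' ->|[]//]; case: (split_ordP j) => [j' ->|[]//];
  rewrite block_mxEul; congr (_ _ _ _); apply: val_inj.
Qed.

(** The last basis vector spans the kernel of [F_(r+1)], and its coordinate functional is the [lam]
    of [plus_retract]; attaching it continues the pattern of both slices by one step. *)
Lemma plus_blockF r :
  plus (Q := blockF F r.+1) (delta_mx 0 ord_max : 'rV_r.+1) = blockF F r.+2.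
Proof.
set X := plus _.
have er : prow X = prow (blockF F r.+2) by rewrite /= addn1.
have ec : pcol X = pcol (blockF F r.+2) by rewrite /= addn1.
apply: (pencil_eq (er := er) (ec := ec)) => i j /=;
  case: (split_ordP i) => [i' ->|i' ->]; case: (split_ordP j) => [j' ->|j' ->];
  rewrite ?(block_mxEul, block_mxEur, block_mxEdl, block_mxEdr) !mxE //= ?(ord1 i') ?(ord1 j') ?addn0 //=.
all: try by rewrite ltn_eqF // ltnW // ltnS.
all: try by rewrite ltn_eqF.
all: try by rewrite gtn_eqF.
- by rewrite -val_eqE eq_sym.
- by rewrite eqSS ltn_eqF.
- by rewrite eqxx.
Qed.

Lemma plus_blockJ l :
  plus (Q := blockJ l.+1) (delta_mx 0 ord_max : 'rV_l.+1) = blockJ l.+2.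
Proof.
set X := plus _.
have er : prow X = prow (blockJ l.+2) by rewrite /= addn1.
have ec : pcol X = pcol (blockJ l.+2) by rewrite /= addn1.
apply: (pencil_eq (er := er) (ec := ec)) => i j /=;
  case: (split_ordP i) => [i' ->|i' ->]; case: (split_ordP j) => [j' ->|j' ->];
  rewrite ?(block_mxEul, block_mxEur, block_mxEdl, block_mxEdr) !mxE //= -?val_eqE /= ?(ord1 i') ?(ord1 j') ?addn0 //=.
all: try by rewrite ltn_eqF // ltnW // ltnS.
all: try by rewrite ltn_eqF.
all: try by rewrite gtn_eqF.
- by rewrite eq_sym.
- by rewrite eqxx.
Qed.

Lemma retract_left_inv b P G : retract b P -> G *m ps1 P = 1%:M ->
  exists H, H *m ps1 b = 1%:M.
Proof.
move=> [f [g [[hf _] _ [_ gf]]]] GP; exists (g.2 *m G *m f.1).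
by rewrite -mulmxA hf mulmxA -(mulmxA g.2) GP mulmx1.
Qed.

Lemma Fmx_mul r (x : 'cV[F]_r.+1) (i : 'I_r) :
  (Fmx F r.+1 *m x) i 0 = x (widen_ord (leqnSn r) i) 0.
Proof.
rewrite mxE; under eq_bigr => j _ do rewrite mxE.
by apply: (@sum_select _ (widen_ord (leqnSn r) i) (fun j => i == j :> nat) (x^~ 0)) => j;
  rewrite eq_sym.
Qed.

Lemma Nmx_mul l (x : 'cV[F]_l.+1) (i : 'I_l) :
  (Nmx l.+1 *m x) (lift ord0 i) 0 = x (widen_ord (leqnSn l) i) 0.
Proof.
rewrite mxE; under eq_bigr => j _ do rewrite mxE.
by apply: (@sum_select _ (widen_ord (leqnSn l) i)
  (fun j => lift ord0 i == j.+1 :> nat) (x^~ 0)) => j; rewrite eq_sym.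
Qed.

Lemma ord_max_or_widen n (i : 'I_n.+1) :
  i = ord_max \/ exists j, i = widen_ord (leqnSn n) j.
Proof.
have := leq_ord i; rewrite leq_eqVlt => /orP[/eqP e|lt]; [left | right].
  exact: val_inj.
by exists (Ordinal lt); apply: val_inj.
Qed.

Lemma Fmx_right_inv r : Fmx F r *m (Fmx F r)^T = 1%:M.
Proof.
case: r => [|r]; first by apply/matrixP => -[].
apply/matrixP => i j.
have -> : (Fmx F r.+1 *m (Fmx F r.+1)^T) i j = (Fmx F r.+1 *m col j (Fmx F r.+1)^T) i 0.
  by rewrite colE mulmxA -colE [RHS]mxE.
by rewrite Fmx_mul !mxE eq_sym.
Qed.

(** Here [V = ker A]: the first slice vanishes and the second is injective, so a single column
    splits off as [J_1]. The quotient [Q] may be empty, which puts this case outside the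
    induction. *)
Lemma blockJ_retract_plus k Q (L : 'M[F]_(k, pcol Q)) : (0 < k)%N ->
  pcol Q = 0%N -> retract (blockJ 1) (plus L).
Proof.
case: k L => // k; case: Q => m n A B /= L _ n0; subst n.
pose e : 'cV[F]_k.+1 := delta_mx 0 0.
have ee : e^T *m e = 1%:M by apply/matrixP => i j; rewrite !ord1 trmx_delta mul_delta_mx !mxE !eqxx.
have N0 : Nmx 1 = 0 by apply/matrixP => i j; rewrite !mxE !ord1.
exists (col_mx 0 e, col_mx 0 e), (row_mx 0 e^T, row_mx 0 e^T); split.
- split; rewrite /= ?N0 mul_block_col !(mul0mx, mulmx0, mul1mx, mulmx1, addr0, add0r) //.
  by rewrite col_mx0.
- split; rewrite /= ?N0 mul_row_block !(mul0mx, mulmx0, mul1mx, mulmx1, addr0, add0r) //.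
  by rewrite [L]thinmx0 mulmx0 row_mx0.
- by rewrite /acomp /= !mul_row_col !mul0mx !add0r ee.
Qed.

Lemma blockF1_retract P (v : 'cV_(pcol P)) : v != 0 -> ps1 P *m v = 0 ->
  ps2 P *m v = 0 -> retract (blockF F 1) P.
Proof.
move=> /matrix0Pn [i [j vi]] v1 v2; rewrite (ord1 j) in vi.
exists (0 : 'M_(_, 0), v), (0 : 'M_(0, _), (v i 0)^-1 *: delta_mx 0 i); split.
- by split; rewrite /= mul0mx ?v1 ?v2.
- by split; apply/matrixP => -[].
- congr (_, _); first by apply/matrixP => -[].
  rewrite /= -scalemxAl -rowE; apply/matrixP => a b; rewrite !ord1 !mxE eqxx.
  by rewrite mulVf.
Qed.

Lemma is_block_tr_or b P : retract b (tr P) -> is_block b ->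
  (exists G, G *m ps1 P = 1%:M) -> exists2 b', is_block b' & retract b' P.
Proof.
move=> rb ib [G GP]; have := retract_tr rb; rewrite trK => {}rb.
case: ib rb => [[r ->]|[r ->]|[chi pchi ->]|[l ->]] rb.
- by exists (blockFT F r.+1) => //; apply: Or42; exists r.
- exists (blockF F r.+1); first by apply: Or41; exists r.
  by rewrite -[blockF _ _]trK.
(* The transposed block need not have the form [blockPhi], but its first slice is invertible, so it
   contains some [blockPhi chi']. *)
- have [n sn] := primary_size pchi.
  have p0 : (0 < prow (tr (blockPhi chi)))%N by rewrite /= sn.
  have rk : \rank (ps1 (tr (blockPhi chi))) = pcol (tr (blockPhi chi)).
    by rewrite /= trmx1 mxrank1.
  have [chi' [pchi' r']] := regular_retract p0 erefl rk.
  by exists (blockPhi chi'); [apply: Or43; exists chi' | apply: retract_trans rb].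
(* A transposed [J] has a nonzero kernel vector, whereas the first slice of [P] is injective. *)
- have [H HJ] := retract_left_inv rb GP.
  have N0 : (Nmx l.+1)^T *m delta_mx 0 0 = 0 :> 'cV_l.+1.
    by rewrite -colE; apply/colP => i; rewrite !mxE.
  have : (delta_mx 0 0 : 'cV[F]_l.+1) = 0.
    by rewrite -[LHS]mul1mx -HJ -mulmxA N0 mulmx0.
  by move/colP/(_ 0); rewrite !mxE !eqxx => /eqP; rewrite oner_eq0.
Qed.

(** The induction hypothesis is a premise so that the lemma applies to [P] and to [tr P] alike. *)
Lemma ker_retract P :
  (forall Q, (prow Q + pcol Q < prow P + pcol P)%N -> (0 < prow Q + pcol Q)%N ->
     exists2 b, is_block b & retract b Q) ->
  (\rank (ps1 P) < pcol P)%N -> exists2 b, is_block b & retract b P.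
Proof.
move=> IH /plus_normal_form [[v v0 [v1 v2]]|[k [Q [L [G [k0 GL QP]]]]]].
  by exists (blockF F 1); [apply: Or41; exists 0%N | apply: (blockF1_retract v0)].
have [/= er ec] := iso_dims QP.
suff [b ib rb] : exists2 b, is_block b & retract b (plus L).
  by exists b => //; apply: retract_trans (iso_retract QP).
have [Q0|Q0] := posnP (pcol Q).
  by exists (blockJ 1); [apply: Or44; exists 0%N | apply: blockJ_retract_plus].
have [||b ib rb] := IH Q; rewrite ?addn_gt0 ?Q0 ?orbT //.
  rewrite -er -ec addnACA -[X in (X < _)%N]addn0 ltn_add2l addn_gt0 k0 //.
(* The first slices of [F] and [J] blocks have a one-dimensional kernel, so [plus_retract] is used
   with [h = 1]; the other two kinds have injective first slices and lift unchanged, with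
   [h = 0]. *)
case: ib rb => [[r ->]|[r ->]|[chi pchi ->]|[l ->]] rb.
- exists (blockF F r.+2); first by apply: Or41; exists r.+1.
  rewrite -plus_blockF.
  have [|H HE] := @inj_left_inv _ _ _ (col_mx (ps1 (blockF F r.+1)) (delta_mx 0 ord_max : 'rV_r.+1)).
    move=> x; rewrite mul_col_mx => /eqP; rewrite col_mx_eq0 => /andP[/eqP Fx /eqP xr].
    apply/colP => i; rewrite mxE; case: (ord_max_or_widen i) => [->|[j ->]].
      by move: xr; rewrite -rowE => /rowP/(_ 0); rewrite !mxE.
    by rewrite -Fmx_mul Fx mxE.
  refine (plus_retract (b := blockF F r.+1) (v := delta_mx ord_max 0 : 'cV_r.+1) HE GL _ _ rb).
    apply/colP => i; rewrite [LHS]Fmx_mul !mxE -val_eqE /= ltn_eqF //.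
  by rewrite mul_delta_mx; apply/matrixP => i j; rewrite !ord1 !mxE !eqxx.
- exists (blockFT F r.+1); first by apply: Or42; exists r.
  rewrite -[blockFT _ _](plus0 (0 : 'M_(0, _))).
  refine (plus_retract (b := blockFT F r.+1) (v := 0 : 'M_(_, 0)) (G := row_mx (Fmx F r.+1) 0) _ GL _ _ rb).
  + by rewrite mul_row_col Fmx_right_inv mul0mx addr0.
  + by rewrite mulmx0.
  + by apply/matrixP => -[].
- exists (blockPhi chi); first by apply: Or43; exists chi.
  rewrite -[blockPhi _](plus0 (0 : 'M_(0, _))).
  refine (plus_retract (b := blockPhi chi) (v := 0 : 'M_(_, 0)) (G := row_mx 1%:M 0) _ GL _ _ rb).
  + by rewrite mul_row_col mul1mx mul0mx addr0.
  + by rewrite mulmx0.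
  + by apply/matrixP => -[].
- exists (blockJ l.+2); first by apply: Or44; exists l.+1.
  rewrite -plus_blockJ.
  have [|H HE] := @inj_left_inv _ _ _ (col_mx (ps1 (blockJ l.+1)) (delta_mx 0 ord_max : 'rV_l.+1)).
    move=> x; rewrite mul_col_mx => /eqP; rewrite col_mx_eq0 => /andP[/eqP Fx /eqP xr].
    apply/colP => i; rewrite mxE; case: (ord_max_or_widen i) => [->|[j ->]].
      by move: xr; rewrite -rowE => /rowP/(_ 0); rewrite !mxE.
    by rewrite -Nmx_mul Fx mxE.
  refine (plus_retract (b := blockJ l.+1) (v := delta_mx ord_max 0 : 'cV_l.+1) HE GL _ _ rb).
    by apply/colP => i; rewrite -colE !mxE ltn_eqF // ltnW // ltnS.
  by rewrite mul_delta_mx; apply/matrixP => i j; rewrite !ord1 !mxE !eqxx.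
Qed.

Lemma exists_retract P : (0 < prow P + pcol P)%N -> exists2 b, is_block b & retract b P.
Proof.
have [n] := ubnP (prow P + pcol P); elim: n P => // n IH P Pn P0.
have [rc|rc] := ltnP (\rank (ps1 P)) (pcol P).
  by apply: ker_retract rc => Q QP Q0; apply: IH => //; apply: leq_trans QP _.
have erc : \rank (ps1 P) = pcol P by apply/eqP; rewrite eqn_leq rank_leq_col.
have left_inv : exists G, G *m ps1 P = 1%:M by apply/row_fullP; rewrite /row_full erc.
have [rr|rr] := ltnP (\rank (ps1 P)) (prow P).
  have [||b ib rb] := @ker_retract (tr P); first last.
  - exact: is_block_tr_or rb ib left_inv.
  - by rewrite /= mxrank_tr.
  move=> Q QP Q0; apply: IH => //; apply: leq_trans QP _.
  by rewrite /= addnC.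
have err : prow P = pcol P by apply/eqP; rewrite -erc eqn_leq rr rank_leq_row.
have [|//|//|chi [pchi rchi]] := @regular_retract _ P.
  by move: P0; rewrite -err addn_gt0 orbb.
by exists (blockPhi chi) => //; apply: Or43; exists chi.
Qed.

End ExistsBlock.

(** * Substitution of the slices in a block *)

Section ActionOnBlocks.
Variable F : fieldType.
Implicit Types (P Q : pencil F) (chi : {poly F}).

Lemma local_gt0 P : local P -> (0 < prow P + pcol P)%N.
Proof.
move=> [nz _]; rewrite lt0n; apply: contraNneq nz => /eqP; rewrite addn_eq0.
move=> /andP[/eqP r0 /eqP c0]; apply/eqP.
by congr (_, _); apply/matrixP => i; case: i; rewrite ?r0 ?c0.
Qed.

Lemma is_block_gt0 P : is_block P -> (0 < prow P + pcol P)%N.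
Proof.
case=> [[r ->]|[r ->]|[chi /primary_size [n sn] ->]|[l ->]] //=.
  by rewrite addnS.
by rewrite sn.
Qed.

Lemma local_block P : local P -> exists2 b, is_block b & iso b P.
Proof.
move=> lP; have [b ib rb] := exists_retract (local_gt0 lP).
by exists b => //; apply: retract_local_iso rb _ lP; apply/neq0_aone/is_block_gt0.
Qed.

Lemma local_phi P : local P -> prow P = pcol P -> \rank (ps1 P) = pcol P ->
  exists2 chi, primary_monic chi & iso (blockPhi chi) P.
Proof.
move=> lP e rP; have := local_gt0 lP; rewrite -e addn_gt0 orbb => P0.
have [chi [pchi rchi]] := regular_retract P0 e rP; exists chi => //.
by apply: retract_local_iso rchi _ lP; case: (local_blockPhi pchi).
Qed.

Lemma tact_blockF a b c d r : a * d - b * c != 0 -> (0 < r)%N ->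
  iso (tact a b c d (blockF F r)) (blockF F r).
Proof.
move=> nz r0; have lr := local_tact nz (local_blockF F r0).
have [P bP iP] := local_block lr; apply: iso_sym.
have [/= er ec] := iso_dims iP.
case: bP iP er ec => [[s ->]|[s ->]|[chi _ ->]|[l ->]] iP /= er ec.
- by move: iP; rewrite ec.
- by move: er; rewrite -ec; case: (s) => [|k] /eqP; rewrite ?(ltn_eqF (leqnSn _)) ?gtn_eqF.
- by move: er; rewrite ec => /eqP; rewrite -[X in X == _](prednK r0) gtn_eqF.
- by move: er; rewrite ec => /eqP; rewrite -[X in X == _](prednK r0) gtn_eqF.
Qed.

Lemma tact_blockFT a b c d r : a * d - b * c != 0 -> (0 < r)%N ->
  iso (tact a b c d (blockFT F r)) (blockFT F r).
Proof.
move=> nz r0; have := iso_tr (tact_blockF nz r0).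
by rewrite /tr /tact /= !linearD /= !linearZ.
Qed.

(** * Substitution in [(I, Phi_chi)] and the polynomial [eta] *)

Section Eta.
Variables (a b c d : F) (chi : {poly F}).
Hypotheses (det_neq0 : a * d - b * c != 0) (chi_primary : primary_monic chi).

Let lin : {poly F} := a%:P + b *: 'X.

(** At the zero of [d - b x] only the top term of [chi] survives. For [b = 0] that zero is at
    infinity, and a leading coefficient replaces the value. *)
Lemma eta_raw_neq0 : eta_raw a b c d chi != 0.
Proof.
have [n sn] := primary_size chi_primary; have [mchi _ _] := chi_primary.
have lc : chi`_n.+1 = 1 by move/monicP: mchi; rewrite lead_coefE sn.
have [b0|b0] := eqVneq b 0.
  have /andP[a0 d0] : (a != 0) && (d != 0).
    by move: det_neq0; rewrite b0 mul0r subr0 mulf_eq0 negb_or.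
  (* The change of variable that turns [a x - c] into [x]. *)
  pose q : {poly F} := a^-1 *: ('X + c%:P).
  suff : (eta_raw a b c d chi \Po q)`_n.+1 != 0.
    by apply: contraNneq => ->; rewrite comp_poly0 coef0.
  have linq : ('X * a%:P - c%:P) \Po q = 'X.
    rewrite rmorphB rmorphM /= comp_polyX !comp_polyC /q -scalerAl mulrDl scalerDr.
    by rewrite !(mulrC _ a%:P) !mul_polyC !scalerA mulVf // !scale1r addrK.
  rewrite /eta_raw raddf_sum coef_sum sn big_ord_recr /= big1 => [|i _].
    rewrite add0r b0 mulr0 subr0 linearZ /= rmorphM !rmorphXn /= linq comp_polyC.
    by rewrite subnn expr0 mulr1 coefZ coefXn eqxx mulr1 lc oner_neq0.
  rewrite b0 mulr0 subr0 linearZ /= rmorphM !rmorphXn /= linq comp_polyC.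
  by rewrite -rmorphXn /= mulrC mul_polyC !coefZ coefXn gtn_eqF ?mulr0.
suff : (eta_raw a b c d chi).[d / b] != 0.
  by apply: contraNneq => ->; rewrite horner0.
have e0 : (d%:P - 'X * b%:P).[d / b] = 0.
  by rewrite !hornerE divfK // subrr.
rewrite /eta_raw horner_sum sn big_ord_recr /= big1 => [|i _]; last first.
  by rewrite hornerZ hornerM !horner_exp e0 expr0n subn_eq0 leqNgt ltn_ord !mulr0.
rewrite add0r subnn expr0 mulr1 hornerZ lc mul1r horner_exp expf_neq0 // !hornerE.
apply: contraNneq det_neq0 => /(congr1 ( *%R b)).
by rewrite mulr0 mulrBr mulrA mulrCA mulfV // mulr1 [d * a]mulrC => ->.
Qed.

(** An upper bound suffices: in [tact_blockPhi] a divisor of degree [l] gives the reverse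
    inequality. *)
Lemma size_eta_raw : (size (eta_raw a b c d chi) <= size chi)%N.
Proof.
apply: (leq_trans (size_sum _ _ _)); apply/bigmax_leqP => i _.
apply: leq_trans (size_scale_leq _ _) _; apply: leq_trans (size_polyMleq _ _) _.
have s2 (p : {poly F}) k : (size p <= 2)%N -> (size (p ^+ k)%R <= k.+1)%N.
  move=> sp; apply: leq_trans (size_poly_exp_leq _ _) _; rewrite ltnS.
  by rewrite -[X in (_ <= X)%N]mul1n leq_mul2r; case: (size p) sp => [|[|[|m]]] //; rewrite orbT.
have l1 (u v : F) : (size ('X * u%:P + v%:P)%R <= 2)%N.
  apply: leq_trans (size_polyD _ _) _; rewrite geq_max size_polyC.
  rewrite (leq_trans (size_polyMleq _ _)) ?size_polyX ?size_polyC; by case: (_ != 0).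
have e1 := s2 _ i (l1 a (- c)); have e2 := s2 _ ((size chi).-1 - i)%N (l1 (- b) d).
have l2 : d%:P - 'X * b%:P = 'X * (- b)%:P + d%:P by rewrite polyCN mulrN addrC.
rewrite l2 -polyCN; have := leq_add e1 e2; rewrite addSn addnS subnKC; last first.
  by rewrite -ltnS prednK // (leq_ltn_trans (leq0n _) (ltn_ord i)).
case: (_ + _)%N => [|m] //=; rewrite ltnS => /leq_trans; apply.
by rewrite prednK // (leq_ltn_trans (leq0n _) (ltn_ord i)).
Qed.

(** If [a + b x] is not prime to [chi], the irreducible [p] divides it and is therefore linear with
    root [-a / b]; this is the eigenvalue that the hypothesis excludes. *)
Lemma lin_unit n (C : 'M[F]_n.+1) : horner_mx C chi = 0 ->
  (forall lam, chi = ('X - lam%:P) ^+ (size chi).-1 -> a + b * lam != 0) ->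
  horner_mx C lin \in unitmx.
Proof.
move=> C0 adm; apply: horner_coprime_unit C0 _.
case: chi_primary adm => mchi _ [p ip [e chi_pe]] adm; rewrite chi_pe in mchi adm *.
rewrite coprimep_sym coprimep_expl // irreducible_poly_coprime //; apply/negP => pl.
have lin0 : lin != 0.
  apply: contraNneq det_neq0 => /polyP l0.
  have := l0 0%N; have := l0 1%N; rewrite !coefD !coefC !coefZ !coefX /= ?coef0.
  by rewrite mulr0 mulr1 addr0 add0r => -> ->; rewrite !mul0r subrr.
have sl : (size lin <= 2)%N.
  rewrite (leq_trans (size_polyD _ _)) // geq_max size_polyC.
  by rewrite (leq_trans (size_scale_leq _ _)) ?size_polyX // andbT; case: (a != 0).
have sp : size p = 2.
  apply/eqP; rewrite eqn_leq ip.1 andbT; exact: leq_trans (dvdp_leq lin0 pl) sl.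
have b0 : b != 0.
  apply: contraTneq (dvdp_leq lin0 pl) => b0; rewrite sp -ltnNge /lin b0 scale0r addr0.
  by rewrite size_polyC; case: (a != 0).
pose lam := - a / b.
have linE : lin = b *: ('X - lam%:P).
  rewrite /lin scalerBr addrC; congr (_ + _).
  by rewrite -mul_polyC -polyCM /lam mulrC divfK // polyCN opprK.
have pX : p %= 'X - lam%:P.
  rewrite -(eqp_rtrans (eqp_scale ('X - lam%:P) b0)) -linE -dvdp_size_eqp //.
  by rewrite sp linE size_scale // size_XsubC.
have chiE : p ^+ e = ('X - lam%:P) ^+ e.
  apply/eqP; rewrite -eqp_monic //; first exact: eqp_exp.
  by rewrite monic_exp ?monicXsubC.
have se : (size (p ^+ e)).-1 = e by rewrite chiE size_exp_XsubC.
have := adm lam; rewrite se => /(_ chiE).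
by rewrite /lam mulrC divfK // subrr eqxx.
Qed.

(** Inverting the substitution: with [V = (a + b C)^-1] and [D = a d - b c], one has
    [a C' - c = D V C] and [d - b C' = D V]. Hence [eta_raw] at [C'] is [(D V)^l chi(C)], where [l]
    is the degree of [chi]. *)
Lemma horner_eta_raw n (C C' : 'M[F]_n.+1) : horner_mx C chi = 0 ->
  horner_mx C lin *m C' = c%:M + d *: C -> horner_mx C lin \in unitmx ->
  horner_mx C' (eta_raw a b c d chi) = 0.
Proof.
move=> C0; have linC : horner_mx C lin = a%:M + b *: C.
  by rewrite /lin rmorphD /= linearZ /= horner_mx_C horner_mx_X.
rewrite linC; set U := _ + _ => UC' uU.
pose V := invmx U.
have CU : C *m U = U *m C by rewrite /U mulmxDl mulmxDr scalar_mxC -scalemxAl -scalemxAr.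
have VC : V *m C = C *m V.
  by apply: (can_inj (mulKmx uU)); rewrite mulKVmx // mulmxA -CU mulmxK.
have C'E : C' = V *m (c%:M + d *: C) by rewrite -UC' mulKmx.
set D := a * d - b * c.
have e1 : horner_mx C' ('X * a%:P - c%:P) = D *: (V *m C).
  rewrite rmorphB rmorphM /= !horner_mx_C horner_mx_X -mulmxE mul_mx_scalar.
  apply: (can_inj (mulKmx uU)); rewrite mulmxBr -!scalemxAr UC' mul_mx_scalar mulKVmx //.
  rewrite /U !scalerDr !scale_scalar_mx !scalerA.
  by rewrite opprD addrACA [c * a]mulrC subrr add0r -scalerBl [c * b]mulrC.
have e2 : horner_mx C' (d%:P - 'X * b%:P) = D *: V.
  rewrite rmorphB rmorphM /= !horner_mx_C horner_mx_X -mulmxE mul_mx_scalar.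
  apply: (can_inj (mulKmx uU)); rewrite mulmxBr -!scalemxAr UC' mul_mx_scalar mulmxV //.
  rewrite /U !scalerDr !scale_scalar_mx !scalerA.
  rewrite opprD addrACA [d * b]mulrC subrr addr0 mulr1.
  by rewrite -raddfB /= [d * a]mulrC.
rewrite /eta_raw linear_sum /=.
transitivity ((D *: V) ^+ (size chi).-1 * horner_mx C chi); last by rewrite C0 mulr0.
have -> : horner_mx C chi = \sum_(i < size chi) chi`_i *: C ^+ i.
  rewrite -{1}(coefK chi) poly_def linear_sum; apply: eq_bigr => i _.
  by rewrite linearZ /= rmorphXn /= horner_mx_X.
rewrite mulr_sumr; apply: eq_bigr => i _.
rewrite linearZ /= rmorphM !rmorphXn /= e1 e2 -scalerAr; congr (_ *: _).
have -> : D *: (V *m C) = (D *: V) * C by rewrite -mulmxE -scalemxAl.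
have comm : GRing.comm (D *: V) C by rewrite /GRing.comm -!mulmxE -scalemxAl -scalemxAr VC.
have li : (i <= (size chi).-1)%N.
  by rewrite -ltnS prednK // (leq_ltn_trans (leq0n _) (ltn_ord i)).
rewrite exprMn_comm // -mulrA (commrX _ (commr_sym (commrX _ comm))).
by rewrite mulrA -exprD subnKC.
Qed.

Lemma tact_blockPhi :
  (forall lam, chi = ('X - lam%:P) ^+ (size chi).-1 -> a + b * lam != 0) ->
  primary_monic (eta a b c d chi) /\ iso (tact a b c d (blockPhi chi)) (blockPhi (eta a b c d chi)).
Proof.
move=> adm; have [n sn] := primary_size chi_primary; have [mchi _ _] := chi_primary.
have lT := local_tact det_neq0 (local_blockPhi chi_primary).
move: lT; rewrite (@blockPhiE _ n.+1) ?sn //; set C := cmx _ _ => lT.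
have C0 : horner_mx C chi = 0 by apply/eqP; rewrite horner_cmx_eq0.
have uU := lin_unit C0 adm.
have linC : horner_mx C lin = a *: 1%:M + b *: C.
  by rewrite /lin rmorphD /= linearZ /= horner_mx_C horner_mx_X scalemx1.
have [||psi ppsi iP] := @local_phi _ lT => //=.
  by rewrite -linC mxrank_unit.
have [mpsi _ _] := ppsi.
have spsi : size psi = n.+2.
  by have [m sm] := primary_size ppsi; have [/= e _] := iso_dims iP; rewrite sm /= in e *; rewrite e.
suff -> : eta a b c d chi = psi by split=> //; apply: iso_sym.
move: iP; rewrite (@blockPhiE _ n.+1 psi) ?spsi //; set E := cmx _ _.
move=> [[X Y] [/= h1 h2] [[X' Y'] [[_ /= Y'Y] [_ /= YY']]]].
have eta0 : horner_mx (invmx (horner_mx C lin) *m (c%:M + d *: C)) (eta_raw a b c d chi) = 0.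
  by apply: (horner_eta_raw C0 _ uU); rewrite mulKVmx.
move: eta0; set C' := invmx _ *m _ => eta0.
have YE : Y *m E = C' *m Y.
  rewrite /C' -[c%:M]scalemx1 -[RHS]mulmxA -h2 -[X]mulmx1 h1 -linC.
  by rewrite -[_ *m Y *m E]mulmxA mulKmx.
have : psi %| eta_raw a b c d chi.
  rewrite -(horner_cmx_eq0 mpsi spsi) -/E; apply/eqP.
  by rewrite -[LHS]mul1mx -Y'Y -mulmxA (horner_intertwine _ YE) eta0 mul0mx mulmx0.
move=> dvd; have sz : size psi = size (eta_raw a b c d chi).
  apply/eqP; rewrite eqn_leq dvdp_leq ?eta_raw_neq0 //= spsi -sn.
  exact: size_eta_raw.
have := eqp_eq (_ : psi %= eta_raw a b c d chi).
rewrite -dvdp_size_eqp // sz eqxx => /(_ isT); move/monicP: mpsi => ->; rewrite scale1r.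
move=> etaE; rewrite /eta -{2}etaE scalerA mulVf ?scale1r //.
by rewrite lead_coef_eq0 eta_raw_neq0.
Qed.

End Eta.
End ActionOnBlocks.

(** * Canonical forms *)

Section CanonicalForm.
Variable F : fieldType.
Implicit Types (P Q : pencil F) (chi : {poly F}) (rs ss : seq nat) (chis : seq {poly F}).

(** Names of blocks, with the decidable equality that [krull_schmidt] asks of its index type. *)
Definition code : Type := (nat + nat + {poly F})%type.
HB.instance Definition _ := Equality.copy code (nat + nat + {poly F})%type.

Definition den (x : code) : pencil F :=
  match x with
  | inl (inl r) => blockF F r
  | inl (inr s) => blockFT F s
  | inr chi => blockPhi chi
  end.

Definition valid (x : code) : Prop :=
  match x with
  | inl (inl r) => (0 < r)%N
  | inl (inr s) => (0 < s)%N
  | inr chi => primary_monic chi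
  end.

Definition codes rs ss chis : seq code :=
  map (inl \o inl) rs ++ map (inl \o inr) ss ++ map inr chis.

Lemma canonE rs ss chis : canon rs ss chis = dsum (map den (codes rs ss chis)).
Proof. by rewrite /canon /codes !map_cat -!map_comp. Qed.

Lemma valid_codes rs ss chis :
  canon_data rs ss chis <-> {in codes rs ss chis, forall x, valid x}.
Proof.
split=> [[/allP vr /allP vs vc] x|v].
  rewrite !mem_cat => /or3P[] /mapP [y ym ->] /=; [exact: vr | exact: vs | exact: vc].
split.
- by apply/allP => y ym; apply: (v (inl (inl y))); rewrite mem_cat (map_f (inl \o inl)).
- by apply/allP => y ym; apply: (v (inl (inr y))); rewrite !mem_cat (map_f (inl \o inr)) ?orbT.
- by move=> y ym; apply: (v (inr y)); rewrite !mem_cat (map_f inr) ?orbT.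
Qed.

Definition code_r (x : code) : option nat := if x is inl (inl r) then Some r else None.
Definition code_s (x : code) : option nat := if x is inl (inr s) then Some s else None.
Definition code_chi (x : code) : option {poly F} := if x is inr chi then Some chi else None.

Lemma pmap_codes rs ss chis :
  [/\ pmap code_r (codes rs ss chis) = rs, pmap code_s (codes rs ss chis) = ss &
      pmap code_chi (codes rs ss chis) = chis].
Proof.
have pmK (T : eqType) (f : T -> code) (g : code -> option T) s :
  pcancel f g -> pmap g (map f s) = s.
  by move=> fg; elim: s => //= x s ->; rewrite fg.
have pmN (T T' : eqType) (f : T -> code) (g : code -> option T') s :
  (forall x, g (f x) = None) -> pmap g (map f s) = [::].
  by move=> fg; elim: s => //= x s ->; rewrite fg.
rewrite /codes !pmap_cat; split.
- by rewrite (pmK _ _ _ rs) // (pmN _ _ _ _ ss) // (pmN _ _ _ _ chis) // !cats0.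
- by rewrite (pmN _ _ _ _ rs) // (pmK _ _ _ ss) // (pmN _ _ _ _ chis) // cats0.
- by rewrite (pmN _ _ _ _ rs) // (pmN _ _ _ _ ss) // (pmK _ _ _ chis).
Qed.

Lemma perm_codes_inv rs ss chis rs' ss' chis' :
  perm_eq (codes rs ss chis) (codes rs' ss' chis') ->
  [/\ perm_eq rs rs', perm_eq ss ss' & perm_eq chis chis'].
Proof.
have [r1 s1 c1] := pmap_codes rs ss chis; have [r2 s2 c2] := pmap_codes rs' ss' chis'.
move=> p; split.
- by rewrite -r1 -r2 perm_pmap.
- by rewrite -s1 -s2 perm_pmap.
- by rewrite -c1 -c2 perm_pmap.
Qed.

Lemma perm_codes rs ss chis rs' ss' chis' :
  perm_eq rs rs' -> perm_eq ss ss' -> perm_eq chis chis' ->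
  perm_eq (codes rs ss chis) (codes rs' ss' chis').
Proof. by move=> r s c; do 2?apply: perm_cat => //; apply: perm_map. Qed.

Lemma perm_codes_pmap (s : seq code) :
  perm_eq s (codes (pmap code_r s) (pmap code_s s) (pmap code_chi s)).
Proof.
elim: s => // -[[r|r]|chi] s IH /=.
- by rewrite /codes /= perm_cons.
- by rewrite /codes /= perm_sym -cat1s perm_catCA /= perm_cons perm_sym.
- rewrite /codes /= catA perm_sym -cat1s perm_catCA /= perm_cons perm_sym.
  by rewrite -catA.
Qed.

Lemma local_den x : valid x -> local (den x).
Proof.
case: x => [[r|r]|chi] /= v.
- exact: local_blockF.
- exact: local_blockFT.
- exact: local_blockPhi.
Qed.

(** The kinds are told apart by having fewer rows than columns, more rows, or equally many; within a
    kind the dimensions or [blockPhi_inj] decide. *)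
Lemma den_inj x y : valid x -> valid y -> iso (den x) (den y) -> x = y.
Proof.
case: x y => [[r|r]|chi] [[s|s]|eta] vx vy i; have [/= er ec] := iso_dims i.
- by rewrite ec.
- by case: r s vx vy er ec {i} => [|r] [|s] //= _ _ -> /eqP; rewrite gtn_eqF.
- by move: ec; rewrite -er => /eqP; rewrite -[X in X == _](prednK vx) gtn_eqF.
- by case: r s vx vy er ec {i} => [|r] [|s] //= _ _ <- /eqP; rewrite ltn_eqF.
- by rewrite er.
- by move: er; rewrite -ec => /eqP; rewrite -[X in X == _](prednK vx) gtn_eqF.
- by move: ec; rewrite er => /eqP; rewrite -[X in _ == X](prednK vy) ltn_eqF.
- by move: er; rewrite ec => /eqP; rewrite -[X in _ == X](prednK vy) ltn_eqF.
- by rewrite (blockPhi_inj vx vy i).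
Qed.

Lemma canon_unique rs ss chis rs' ss' chis' :
  canon_data rs ss chis -> canon_data rs' ss' chis' ->
  iso (canon rs ss chis) (canon rs' ss' chis') ->
  [/\ perm_eq rs rs', perm_eq ss ss' & perm_eq chis chis'].
Proof.
move=> /valid_codes v /valid_codes v'; rewrite !canonE => i.
apply: perm_codes_inv; apply: (krull_schmidt (den := den)) i.
  by move=> x; rewrite mem_cat => /orP[/v|/v']; apply: local_den.
by move=> x y /v vx /v' vy; apply: den_inj.
Qed.

Lemma canon_perm rs ss chis rs' ss' chis' :
  perm_eq rs rs' -> perm_eq ss ss' -> perm_eq chis chis' ->
  iso (canon rs ss chis) (canon rs' ss' chis').
Proof. by move=> *; rewrite !canonE; apply: dsum_perm; apply: perm_codes. Qed.

Section Action.
Variables (a b c d : F).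
Hypothesis det_neq0 : a * d - b * c != 0.

Lemma eta_primary chis : admissible a b c d chis ->
  (forall chi, chi \in chis -> primary_monic chi) ->
  forall chi, chi \in map (eta a b c d) chis -> primary_monic chi.
Proof.
move=> [_ adm] prim _ /mapP [chi chi_in ->].
by have [] := tact_blockPhi det_neq0 (prim _ chi_in) (adm _ chi_in).
Qed.

Lemma tact_canon rs ss chis : canon_data rs ss chis -> admissible a b c d chis ->
  iso (tact a b c d (canon rs ss chis)) (canon rs ss (map (eta a b c d) chis)).
Proof.
move=> dat [_ adm]; have v := (valid_codes _ _ _).1 dat.
pose h (x : code) : code := if x is inr chi then inr (eta a b c d chi) else x.
have -> : canon rs ss (map (eta a b c d) chis) = dsum (map (den \o h) (codes rs ss chis)).
  by rewrite canonE /codes !map_cat -!map_comp.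
rewrite canonE tact_dsum -map_comp; apply: dsum_eq_iso => x xin; have := v x xin.
case: x xin => [[r|r]|chi] xin /= vx.
- exact: tact_blockF.
- exact: tact_blockFT.
- have chi_in : chi \in chis.
    by move: xin; rewrite !mem_cat => /or3P[] /mapP [y ym] // [->].
  by have [_] := tact_blockPhi det_neq0 vx (adm _ chi_in).
Qed.

(* When [a + b lam = 0] the first slice of the transformed block is singular but
   square, unlike that of any block of a canonical form. *)
Lemma iso_admissible rs ss chis rs' ss' chis' :
  canon_data rs ss chis -> canon_data rs' ss' chis' ->
  iso (tact a b c d (canon rs ss chis)) (canon rs' ss' chis') ->
  admissible a b c d chis.
Proof.
move=> /valid_codes v /valid_codes v'; rewrite !canonE tact_dsum -map_comp => i.
split=> // chi chi_in lam chiE; apply/eqP => ablam.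
have xin : (inr chi : code) \in codes rs ss chis by rewrite !mem_cat (map_f inr) ?orbT.
have pchi : primary_monic chi := v _ xin.
case/splitPr: xin i => t1 t2 i.
(* The transformed block of [chi] is still local, so it is isomorphic to some summand of the second
   canonical form. *)
have [u1 [y [u2 [yE iy _]]]] := local_summand (local_tact det_neq0 (local_blockPhi pchi))
  (fun j jin => local_den (v' j jin)) (iso_trans (iso_sym (dsum_rem _ _ _ _)) i).
have vy : valid y by apply: v'; rewrite yE mem_cat inE eqxx orbT.
have [/= er ec] := iso_dims iy; have [n sn] := primary_size pchi.
case: y vy iy er ec {yE} => [[r|r]|eta] /= vy iy er ec.
- by move: ec; rewrite er => /eqP; rewrite -[X in _ == X](prednK vy) ltn_eqF.
- by move: er; rewrite ec => /eqP; rewrite -[X in _ == X](prednK vy) ltn_eqF.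
move: iy; rewrite (@blockPhiE _ n.+1 chi) ?sn // (@blockPhiE _ n.+1 eta) -?er ?sn //.
set C := cmx _ _ => -[[X Y] [/= h1 _] [[X' Y'] [_ [/= _ YY']]]].
have [mchi _ _] := pchi.
(* [a + b C] equals [b (C - lam)] and is nilpotent, while the isomorphism to a block with first
   slice 1 makes it invertible. *)
have U0 : (a *: 1%:M + b *: C) ^+ n.+1 = 0.
  have -> : a *: 1%:M + b *: C = b *: horner_mx C ('X - lam%:P).
    rewrite rmorphB /= horner_mx_X horner_mx_C scalerBr !scale_scalar_mx mulr1.
    have -> : a = - (b * lam) by apply/eqP; rewrite -addr_eq0 ablam.
    by rewrite raddfN /= addrC.
  have chi0 : horner_mx C chi == 0 by rewrite horner_cmx_eq0.
  have chiE' : chi = ('X - lam%:P) ^+ n.+1 by rewrite {1}chiE sn.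
  by rewrite exprZn -rmorphXn /= -chiE' (eqP chi0) scaler0.
have : (a *: 1%:M + b *: C) ^+ n.+1 \is a GRing.unit.
  rewrite unitrX //; have : Y' *m (X *m (a *: 1%:M + b *: C)) = 1%:M.
    rewrite h1 mul1mx; exact: mulmx1C.
  by rewrite mulmxA => /mulmx1_unit [].
by rewrite U0 unitr0.
Qed.

End Action.

(** Exchanging the slices moves the eigenvalue at infinity to 0, so [tact_blockPhi] also covers the
    blocks [J]. *)
Lemma blockJE l : blockJ F l.+1 = tact 0 1 1 0 (blockPhi 'X^(l.+1)).
Proof.
rewrite (@blockPhiE _ l.+1) ?size_polyXn // /tact /= !scale0r !scale1r add0r addr0.
congr Pencil; apply/matrixP => i j; rewrite !mxE coefXn (ltn_eqF (ltn_ord i)) oppr0.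
by rewrite if_same add0r.
Qed.

Lemma primary_Xn l : primary_monic ('X^(l.+1) : {poly F}).
Proof.
split; rewrite ?monicXn ?size_polyXn //; exists 'X; last by exists l.+1.
by have := irredp_XsubC (0 : F); rewrite subr0.
Qed.

(* Summands of a pencil before [T] is applied: [inr l] stands for [blockJ l.+1],
   the block with eigenvalue at infinity. *)
Definition jden (x : code + nat) : pencil F :=
  match x with inl x => den x | inr l => blockJ F l.+1 end.

Definition jvalid (x : code + nat) : Prop := if x is inl x then valid x else True.

Lemma is_block_jden P : is_block P -> exists2 x, jvalid x & P = jden x.
Proof.
case=> [[r ->]|[r ->]|[chi pchi ->]|[l ->]].
- by exists (inl (inl (inl r.+1))).
- by exists (inl (inl (inr r.+1))).
- by exists (inl (inr chi)).
- by exists (inr l).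
Qed.

Lemma decompose P : exists s : seq (code + nat)%type,
  {in s, forall x, jvalid x} /\ iso P (dsum (map jden s)).
Proof.
have [n] := ubnP (prow P + pcol P); elim: n P => // n IH P Pn.
have [P0|P0] := posnP (prow P + pcol P).
  exists [::]; split=> //; case: P P0 {Pn} => r c A B /= /eqP.
  rewrite addn_eq0 => /andP[/eqP r0 /eqP c0]; subst r c.
  have -> : Pencil A B = pempty F by congr Pencil; apply/matrixP => -[].
  exact: iso_refl.
have [b ib [f [g [hf hg gf]]]] := exists_retract P0.
have [Q [j [q bQ]]] := retract_split hf hg gf.
have iP := biprod_iso bQ (pdsum_biprod b Q).
have [/= er ec] := iso_dims iP.
have [|s [vs is_]] := IH Q.
  have := is_block_gt0 ib; move: Pn; rewrite er ec addnACA ltnS => Pn b0.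
  by apply: leq_trans Pn; rewrite -[X in (X < _)%N]add0n ltn_add2r.
have [x vx bE] := is_block_jden ib; exists (x :: s); split.
  by move=> y; rewrite inE => /predU1P[->|/vs].
by apply: iso_trans iP _; rewrite /= -bE; apply: pdsum_iso; [exact: iso_refl|].
Qed.

(** For the square blocks this bounds their number by [min(m,n)]. *)
Lemma count_square_dsum (s : seq (code + nat)%type) (p : pred (code + nat)%type) :
  (forall x, x \in s -> p x -> (0 < prow (jden x))%N /\ (0 < pcol (jden x))%N) ->
  (count p s <= prow (dsum (map jden s)))%N /\ (count p s <= pcol (dsum (map jden s)))%N.
Proof.
elim: s => //= x s IH px; have [|hr hc] := IH.
  by move=> y ys; apply: px; rewrite inE ys orbT.
have := px x; rewrite inE eqxx => /(_ isT).
case: (p x) => [/(_ isT) [xr xc]|_]; rewrite ?add1n ?add0n.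
  by split; [apply: leq_add xr hr | apply: leq_add xc hc].
by split; [apply: leq_trans hr _ | apply: leq_trans hc _]; rewrite leq_addl.
Qed.

Lemma avoid_eigenvalues (s : seq F) chis : uniq s -> (size chis < size s)%N ->
  exists2 x, x \in s & forall chi lam, chi \in chis -> (1 < size chi)%N ->
    chi = ('X - lam%:P) ^+ (size chi).-1 -> lam != x.
Proof.
(* One excluded value per [chi]: its first root in [s], which for a power of [X - lam] can only be
   [lam]. If there is none, [nth] returns the default 0, still a single value. *)
move=> us lt; pose bad := [seq nth 0 s (find (root chi) s) | chi <- chis].
have [x xs xbad] : exists2 x, x \in s & x \notin bad.
  apply/hasP; rewrite has_predC; apply/negP => /allP sub.
  by have := uniq_leq_size us sub; rewrite size_map leqNgt lt.
exists x => // chi lam chi_in schi chiE; apply: contraNneq xbad => lamx.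
have rootE y : root chi y = (y == x).
  by rewrite chiE lamx; case: (size chi) schi => [|[|k]] // _; rewrite root_exp_XsubC.
apply/mapP; exists chi => //.
have hx : has (root chi) s by apply/hasP; exists x; rewrite ?rootE.
by have := nth_find 0 hx; rewrite rootE => /eqP.
Qed.

Lemma exists_canonical m n (A1 A2 : 'M[F]_(m, n)) (s : seq F) :
  uniq s -> size s = minn m n ->
  exists rs ss chis, is_canonical_form (Pencil A1 A2) rs ss chis.
Proof.
move=> us sz; have [L [vL iL]] := decompose (Pencil A1 A2).
pose chiL : seq {poly F} := pmap (fun x => if x is inl x then code_chi x else None) L.
have chiL_in chi : (inl (inr chi) : code + nat) \in L -> chi \in chiL.
  by move=> xin; rewrite mem_pmap; apply/mapP; exists (inl (inr chi)).
pose isJ (x : code + nat) := if x is inr _ then true else false.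
have [a [b [c [d [det adm bJ]]]]] : exists a b c d : F, [/\ a * d - b * c != 0,
    forall chi lam, (inl (inr chi) : code + nat) \in L ->
      chi = ('X - lam%:P) ^+ (size chi).-1 -> a + b * lam != 0 &
    has isJ L -> b != 0].
  have [hJ|nJ] := boolP (has isJ L); last first.
    exists 1, 0, 0, 1; split=> //; first by rewrite mulr1 mul0r subr0 oner_neq0.
    by move=> *; rewrite mul0r addr0 oner_neq0.
  pose isR (x : code + nat) := match x with inl (inr _) => true | inr _ => true | _ => false end.
  have [|hr hc] := @count_square_dsum L isR.
    move=> [[[r|r]|chi]|l] // xin _ /=.
    by have [k sk] := primary_size (vL _ xin); rewrite sk.
  have [/= er ec] := iso_dims iL.
  (* Strict because [isR] also counts the blocks [J], and at least one is present. *)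
  have cnt : (size chiL < count isR L)%N.
    have -> : count isR L = (size chiL + count isJ L)%N.
      by rewrite /chiL; elim: L {vL iL chiL chiL_in hJ hr hc er ec} => //= -[[[r|r]|chi]|l] t -> //=; rewrite ?addnS ?add0n.
    by rewrite -[X in (X < _)%N]addn0 ltn_add2l -has_count.
  have szs : (size chiL < size s)%N.
    by rewrite sz leq_min -{1}er -ec in hr hc *; rewrite (leq_trans cnt) // (leq_trans cnt).
  have [x _ xne] := avoid_eigenvalues us szs.
  (* The new slices are [B - x A] and [A]: the first has eigenvalue [lam - x] on a block with
     eigenvalue [lam], and 1 on every [J]. *)
  exists (- x), 1, 1, 0; split=> [|chi lam xin chiE|_]; last exact: oner_neq0.
    by rewrite mulr0 mulr1 sub0r oppr_eq0 oner_neq0.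
  rewrite mul1r addrC subr_eq0; apply: (xne chi) => //; first exact: chiL_in.
  by have [k ->] := primary_size (vL _ xin).
have [t [vt it]] : exists t : seq code, {in t, forall x, valid x} /\
    iso (dsum (map (tact a b c d) (map jden L))) (dsum (map den t)).
  elim: L {iL chiL chiL_in} vL adm bJ => [|x L IH] vL adm bJ.
    by exists [::]; split=> //; apply: iso_refl.
  have [||| t [vt it]] := IH.
  - by move=> y yL; apply: vL; rewrite inE yL orbT.
  - by move=> chi lam yL; apply: adm; rewrite inE yL orbT.
  - by move=> hJ; apply: bJ; rewrite /= hJ orbT.
  have [y vy iy] : exists2 y, valid y & iso (tact a b c d (jden x)) (den y).
    have := vL x; rewrite inE eqxx => /(_ isT).
    have adm_x chi lam : x = inl (inr chi) -> chi = ('X - lam%:P) ^+ (size chi).-1 ->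
        a + b * lam != 0 by move=> xE; apply: adm; rewrite xE inE eqxx.
    case: x adm_x bJ {vL adm} => [[[r|r]|chi]|l] adm_x bJ /= vx.
    - by exists (inl (inl r)); [|exact: tact_blockF].
    - by exists (inl (inr r)); [|exact: tact_blockFT].
    - have [p i] := tact_blockPhi det vx (fun lam => @adm_x chi lam erefl).
      by exists (inr (eta a b c d chi)).
    (* The exchange of slices inside [J] swaps [a] with [b] and [c] with [d]. As the only eigenvalue
       of [Phi] for ['X^(l.+1)] is 0, the condition to check is [b != 0]. *)
    rewrite blockJE tact_comp !(mulr0, mulr1, add0r, addr0).
    have det' : b * c - a * d != 0 by rewrite -opprB oppr_eq0.
    have [|p i] := tact_blockPhi det' (primary_Xn l).
      move=> lam; rewrite size_polyXn /= => /(congr1 (horner^~ lam)).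
      rewrite !horner_exp !hornerE subrr expr0n /= => /eqP.
      by rewrite expf_eq0 /= => /eqP ->; rewrite mulr0 addr0 bJ.
    by exists (inr (eta b a d c 'X^(l.+1))).
  exists (y :: t); split; last exact: pdsum_iso.
  by move=> z; rewrite inE => /predU1P[->|/vt].
exists (pmap code_r t), (pmap code_s t), (pmap code_chi t); split.
  by apply/valid_codes => x; rewrite -(perm_mem (perm_codes_pmap t)); apply: vt.
apply/pencil_equivP; exists a, b, c, d; split=> //.
apply: iso_trans (iso_tact a b c d iL) _; rewrite tact_dsum canonE.
apply: iso_trans it _; exact: dsum_perm (perm_codes_pmap t).
Qed.

Lemma pencil_equiv_trans_inv P Q R : pencil_equiv P Q -> pencil_equiv P R ->
  exists a b c d, a * d - b * c != 0 /\ iso (tact a b c d Q) R.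
Proof.
move=> /pencil_equivP [a [b [c [d [D0 iQ]]]]] /pencil_equivP [a' [b' [c' [d' [D0' iR]]]]].
pose D := a * d - b * c.
(* The coefficients are the entries of the inverse of the first substitution matrix. *)
have QP : iso (tact (d / D) (- b / D) (- c / D) (a / D) Q) P.
  apply: iso_trans (iso_sym (iso_tact _ _ _ _ iQ)) _.
  have -> : tact (d / D) (- b / D) (- c / D) (a / D) (tact a b c d P) = P.
    by rewrite tact_comp -[RHS]tact1 /D; congr tact; field.
  exact: iso_refl.
have QR := iso_trans (iso_tact a' b' c' d' QP) iR; rewrite tact_comp in QR.
do 4!eexists; split; last exact: QR.
rewrite (_ : _ - _ = (a' * d' - b' * c') / D); last by rewrite /D; field.
by rewrite mulf_neq0 ?invr_eq0.
Qed.

End CanonicalForm.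

Theorem theorem1 (F : fieldType) (m n : nat) (A1 A2 : 'M[F]_(m, n))
  (Hcard : exists s : seq F, uniq s /\ size s = minn m n) :
  let A := Pencil A1 A2 in
  (exists (rs ss : seq nat) (chis : seq {poly F}), is_canonical_form A rs ss chis)
  /\ (forall rs ss chis rs' ss' chis',
        is_canonical_form A rs ss chis -> is_canonical_form A rs' ss' chis' ->
        related rs ss chis rs' ss' chis')
  /\ (forall rs ss chis rs' ss' chis',
        is_canonical_form A rs ss chis -> related rs ss chis rs' ss' chis' ->
        is_canonical_form A rs' ss' chis').
Proof.
move=> A; have [s [us sz]] := Hcard; split; last split.
- exact: exists_canonical us sz.
- move=> rs ss chis rs' ss' chis' [dat AQ] [dat' AQ'].
  have [a [b [c [d [det i]]]]] := pencil_equiv_trans_inv AQ AQ'.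
  have adm := iso_admissible det dat dat' i.
  have dat_eta : canon_data rs ss (map (eta a b c d) chis).
    by have [r0 s0 chi0] := dat; split=> //; apply: (eta_primary det adm chi0).
  have [pr ps pchi] := canon_unique dat_eta dat'
    (iso_trans (iso_sym (tact_canon det dat adm)) i).
  split=> //; exists a, b, c, d; split=> //.
  by rewrite perm_sym.
move=> rs ss chis rs' ss' chis' [dat /pencil_equivP [a0 [b0 [c0 [d0 [det0 AQ]]]]]].
move=> [pr ps [a [b [c [d [adm pchi]]]]]]; have [det _] := adm.
have [r0 s0 chi0] := dat; split.
  split; rewrite -1?(perm_all _ pr) -1?(perm_all _ ps) // => chi.
  by rewrite (perm_mem pchi); apply: (eta_primary det adm chi0).
apply/pencil_equivP.
have i := iso_trans (iso_tact a b c d AQ) (tact_canon det dat adm).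
rewrite tact_comp in i; do 4!eexists; split; last first.
  by apply: (iso_trans i); apply: canon_perm => //; rewrite perm_sym.
rewrite (_ : _ - _ = (a * d - b * c) * (a0 * d0 - b0 * c0)); last by ring.
exact: mulf_neq0.
Qed.
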